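(* Consider the total row $d_1=[\widetilde{\operatorname{Sq}}^1\ \widetilde{\operatorname{Sq}}^2\ \widetilde{\operatorname{Sq}}^4\ \widetilde{\operatorname{Sq}}^6\ \widetilde{\operatorname{Sq}}^8\ \cdots]$ with columns $e_1,e_2,e_4,e_6,e_8,\dots$. In total degree at most $8$, the indecomposable homogeneous primary syzygies for this row are represented by $$q_2=\operatorname{Sq}^1e_1,\qquad z_4=\operatorname{Sq}^2e_2+\operatorname{Sq}^3e_1,\qquad z_5=\operatorname{Sq}^2\operatorname{Sq}^1e_2+\operatorname{Sq}^1e_4+\operatorname{Sq}^4e_1,$$ $$\widetilde r_6=e_6+\operatorname{Sq}^2e_4+\operatorname{Sq}^5e_1,\qquad z_8=\operatorname{Sq}^6e_2+\operatorname{Sq}^4e_4+\operatorname{Sq}^2e_6.$$ Their secondary tracks (elements of $D_1$ whose boundary is the value of $d_1$ on the syzygy) may be chosen, respectively, as $$H_{1,1}=u[1,1],\qquad H_4=u[2,2],$$ $$H_5=\operatorname{Sq}^2u[1,2]+u[2,3]+u[1,4]+\mu_0(\operatorname{Sq}^2\operatorname{Sq}^3)+\mu_0(\operatorname{Sq}^5),$$ $$H_6=u[2,4],\qquad H_8=u[4,4]+u[2,6]+\mu_0(\operatorname{Sq}^7\operatorname{Sq}^1).$$ The corresponding even-column syzygies in $K_F=\ker(\nu)$ are $\rho_4=\operatorname{Sq}^2e_2$, $\rho_5=\operatorname{Sq}^2\operatorname{Sq}^1e_2+\operatorname{Sq}^1e_4$, $r_6=e_6+\operatorname{Sq}^2e_4$,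 and $\rho_8=\operatorname{Sq}^6e_2+\operatorname{Sq}^4e_4+\operatorname{Sq}^2e_6$.
   Context: $\mathcal A$ is the mod-$2$ Steenrod algebra; $e_1$ has degree $1$ and $e_{2i}$ degree $2i$. A primary syzygy is a homogeneous element $\sum a_\lambda e_\lambda$ of the free left $\mathcal A$-module on $e_1,e_2,e_4,e_6,\dots$ with $a_1\operatorname{Sq}^1+\sum_{i>0}a_{2i}\operatorname{Sq}^{2i}=0$ in $\mathcal A$; indecomposable means nonzero modulo the submodule generated by positive-degree Steenrod multiples of syzygies of lower degree. Also $\nu:M_F=\bigoplus_{i>0}\Sigma^{2i}\mathcal Ae_{2i}\to\mathcal A/\mathcal A\operatorname{Sq}^1$ is the left $\mathcal A$-linear map $e_{2i}\mapsto\overline{\operatorname{Sq}^{2i}}$. For $0<a<2b$ put $[a,b]=\operatorname{Sq}^a\operatorname{Sq}^b+\sum_{k=0}^{\lfloor a/2\rfloor}\binom{b-k-1}{a-2k}\operatorname{Sq}^{a+b-k}\operatorname{Sq}^k$ (binomials mod $2$, $\operatorname{Sq}^0=1$). $D_1\xrightarrow{\partial}D_0\to\mathcal A$ is Nassau's pair-algebra model at $2$ of Baues's secondary Steenrod algebra. $D_0$ (with $\mathbb Z/4$ coefficients) is generated by lifts $\widetilde{\operatorname{Sq}}^a$ and elements $Y_{k,l}$; $D_1$ by a copy of $\mathcal A$ and elements $\mu_0a$, $U_{k,l}a$, with $\partial(\mu_0a)=2a$, $\partial(U_{k,l}a)=Y_{k,l}a$. The secondary Adem tracks $u[a,b]$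 (Baues relation tracks transported to $D_1$) satisfy $\partial(\alpha u[a,b]\beta)=\alpha[a,b]\beta$ for words $\alpha,\beta$. Steenrod words are lifted to $D_0$ by replacing each $\operatorname{Sq}^a$ by $\widetilde{\operatorname{Sq}}^a$. The term $\mu_0(a)$ is the track that cancels a duplicate pair $a+a$ of identical lifted $D_0$-monomials (signs are treated as immaterial). *)

(* Defs.v *)
(* Mathematical Components, with the monoid algebras {malg G[K]} of multinomials
   used as the free (finitely supported) modules on a set K of basis elements. *)
From HB Require Import structures.
From mathcomp Require Import all_boot all_order all_algebra.
From mathcomp Require Import finmap.
From mathcomp.multinomials Require Import monalg.

Set Implicit Arguments.
Unset Strict Implicit.
Unset Printing Implicit Defensive.

Import GRing.Theory.
Local Open Scope ring_scope.

(* An exponent sequence R = (r_1, r_2, ...) is stored as [:: r_1; r_2; ...]; the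
   canonical ones have no trailing zero, so that they index bases faithfully. *)

Definition trim (r : seq nat) : seq nat :=
  foldr (fun x s => if (x == 0%N) && nilp s then [::] else x :: s) [::] r.

Definition milnor_exp : Type := {r : seq nat | last 1%N r != 0%N}.
HB.instance Definition _ := Choice.on milnor_exp.

Lemma last_trim (r : seq nat) : last 1%N (trim r) != 0%N.
Proof.
elim: r => //= x r; case: (trim r) => [_|y s]; last by rewrite andbF.
by rewrite andbT; case: ifP => //= /negbT.
Qed.

Definition mexp (r : seq nat) : milnor_exp := exist _ (trim r) (last_trim r).

(* |xi_i| = 2^i - 1, and xi_i is stored at position i - 1. *)
Definition exp_deg (r : seq nat) : nat :=
  sumn (mkseq (fun i => nth 0 r i * (2 ^ i.+1 - 1))%N (size r)).

Definition exp_add (p q : seq nat) : seq nat :=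
  mkseq (fun i => nth 0 p i + nth 0 q i)%N (maxn (size p) (size q)).

Definition exp_le (p r : seq nat) : bool :=
  all (fun i => nth 0 p i <= nth 0 r i)%N (iota 0%N (size p)).

Definition exp_sub (r p : seq nat) : seq nat :=
  mkseq (fun i => nth 0 r i - nth 0 p i)%N (size r).

(* The exponent sequence of xi_i ^ e, where xi_0 = 1.  With e = 1 this is the
   sequence usually written Delta_i. *)
Definition xi (i e : nat) : seq nat :=
  if i is i'.+1 then ncons i' 0%N [:: e] else [::].

(* Milnor's product formula.  A Milnor matrix (x_ij), i, j >= 0, x_00 omitted,
   for (R, S) satisfies r_i = \sum_j 2^j x_ij and s_j = \sum_i x_ij.  It is
   determined by its interior X = (x_ij)_{i, j >= 1}, which is what we enumerate. *)

Fixpoint seqs_below (s : seq nat) : seq (seq nat) :=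
  if s is c :: s' then [seq x :: y | x <- iota 0%N c.+1, y <- seqs_below s']
  else [:: [::]].

Fixpoint matrices_below (m : nat) (s : seq nat) : seq (seq (seq nat)) :=
  if m is m'.+1 then [seq x :: X | x <- seqs_below s, X <- matrices_below m' s]
  else [:: [::]].

Definition interior (X : seq (seq nat)) (i j : nat) : nat := nth 0%N (nth [::] X i) j.

Definition row_weight (X : seq (seq nat)) (n i : nat) : nat :=
  sumn (mkseq (fun j => 2 ^ j.+1 * interior X i j)%N n).

Definition col_weight (X : seq (seq nat)) (m j : nat) : nat :=
  sumn (mkseq (fun i => interior X i j) m).

Definition milnor_interiors (r s : seq nat) : seq (seq (seq nat)) :=
  [seq X <- matrices_below (size r) s
     | all (fun i => row_weight X (size s) i <= nth 0 r i)%N (iota 0%N (size r))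
       && all (fun j => col_weight X (size r) j <= nth 0 s j)%N (iota 0%N (size s))].

Definition milnor_entry (r s : seq nat) (X : seq (seq nat)) (i j : nat) : nat :=
  match i, j with
  | 0, 0 => 0
  | i'.+1, 0 => nth 0 r i' - row_weight X (size s) i'
  | 0, j'.+1 => nth 0 s j' - col_weight X (size r) j'
  | i'.+1, j'.+1 => interior X i' j'
  end%N.

Definition milnor_diag r s X (k : nat) : seq nat :=
  mkseq (fun i => milnor_entry r s X i (k - i)%N) k.+1.

Definition milnor_exponent r s X : seq nat :=
  mkseq (fun k => sumn (milnor_diag r s X k.+1)) (size r + size s).

Fixpoint multinomial (t : seq nat) : nat :=
  if t is x :: t' then ('C(sumn t, x) * multinomial t')%N else 1%N.

Definition milnor_coef r s X : nat :=
  foldr (fun k c => multinomial (milnor_diag r s X k) * c)%N 1%N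
    (iota 1%N (size r + size s)).

(* Over 'F_2 this is the product of the Steenrod algebra.  Over 'Z_4 the same
   integral coefficients give only one summand of the product of D0. *)
Definition milnor_mul (G : comNzRingType) (x y : {malg G[milnor_exp]}) :
    {malg G[milnor_exp]} :=
  \sum_(r <- msupp x) \sum_(s <- msupp y)
    \sum_(X <- milnor_interiors (val r) (val s))
      << x@_r * y@_s * (milnor_coef (val r) (val s) X)%:R
         *g mexp (milnor_exponent (val r) (val s) X) >>.

(* The mod 2 Steenrod algebra, on its Milnor basis Sq(R). *)

Definition A : zmodType := {malg 'F_2[milnor_exp]}.

Definition SqR (r : seq nat) : A := << 1 *g mexp r >>.
Definition Sq (n : nat) : A := SqR [:: n].
Definition mulA (a b : A) : A := milnor_mul a b.
Definition oneA : A := SqR [::].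

Definition wordA (w : seq nat) : A := foldr (fun n x => mulA (Sq n) x) oneA w.

Definition homogA (n : nat) (a : A) : Prop :=
  forall r, r \in msupp a -> exp_deg (val r) = n.

(* The contraction A_* (x) A -> A: xi^p sends Sq(R) to Sq(R - p). *)
Definition cap (p : seq nat) (a : A) : A :=
  \sum_(r <- msupp a | exp_le p (val r)) << a@_r *g mexp (exp_sub (val r) p) >>.

Definition kappa (a : A) : A := cap (xi 1 1) a.

(* The algebra D0 is dual to the Hopf algebra representing the power series
     f(x) = \sum_k xi_k x^(2^k) + \sum_{k < l} 2 xi_{k,l} x^(2^k + 2^l)  (xi_0 = 1)
   under composition modulo 4; in a product the left factor is the inner series.
   An element is a combination of the duals Sq~(R) of xi^R, with coefficients in
   Z/4, and of the duals Y_{k,l} Sq(R) of 2 xi_{k,l} xi^R, with coefficients in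
   Z/2; so Y_{k,l} A is a free right A-module of rank one for each k < l. *)

Definition ypair : Type := {p : nat * nat | (p.1 < p.2)%N}.
HB.instance Definition _ := Choice.on ypair.

Definition ypair01 : ypair := exist (fun p : nat * nat => is_true (p.1 < p.2)%N) (0%N, 1%N) isT.

(* The pair {k, l} in increasing order; only used for k != l. *)
Definition ypair_of (k l : nat) : ypair := insubd ypair01 (minn k l, maxn k l).

Definition D0 : zmodType := ({malg 'Z_4[milnor_exp]} * {malg A[ypair]})%type.

Definition SqtR (r : seq nat) : D0 := (<< 1 *g mexp r >>, 0).
Definition Sqt (n : nat) : D0 := SqtR [:: n].
Definition oneD : D0 := SqtR [::].
Definition Yelt (p : ypair) (a : A) : D0 := (0, << a *g p >>).

Definition projA (x : {malg 'Z_4[milnor_exp]}) : A :=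
  \sum_(r <- msupp x) << ((val (x@_r))%:R : 'F_2) *g r >>.

(* D0 -> A; its kernel is 2 D0 + \sum Y_{k,l} A. *)
Definition projD (x : D0) : A := projA x.1.

(* a |-> 2 a, computed on any lift of a to D0. *)
Definition twice (a : A) : D0 :=
  (\sum_(r <- msupp a) << (2 * val (a@_r))%:R *g r >>, 0).

(* For k < l and symbols X_{k,l} standing for Y_{k,l} or U_{k,l}:
     a X_{k,l} = \sum_{i, j} X_{k+i, l+j} cap(xi_i^(2^k) xi_j^(2^l), a),
   where the X_{m,n} with m >= n have still to be expressed by the basis, the
   element X_{m,n} b being given by T m n b. *)
Definition left_expand (V : zmodType) (T : nat -> nat -> A -> V)
    (a : A) (y : {malg A[ypair]}) : V :=
  \sum_(p <- msupp y) \sum_(r <- msupp a)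
    \sum_(i < (size (val r)).+1) \sum_(j < (size (val r)).+1)
      T ((val p).1 + i)%N ((val p).2 + j)%N
        (mulA (cap (exp_add (xi i (2 ^ (val p).1)) (xi j (2 ^ (val p).2)))
                   << a@_r *g r >>) (y@_p)).

(* Y_{l,k} = Y_{k,l} and Y_{k,k} = 2 Sq(Delta_{k+1}), as 2 x^(2^k + 2^k) =
   2 x^(2^(k+1)). *)
Definition Yterm (k l : nat) (a : A) : D0 :=
  if k == l then twice (mulA (SqR (xi k.+1 1)) a) else Yelt (ypair_of k l) a.

(* The Y-part of a product of two combinations of the Sq~(R).  It comes from
     (\sum_i xi_i x^(2^i))^(2^k) = \sum_i xi_i^(2^k) x^(2^(i+k))
       + 2 \sum_{i<j} (xi_i xi_j)^(2^(k-1)) x^(2^(i+k-1) + 2^(j+k-1))  (mod 4)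
   for k >= 1; below k stands for k - 1. *)
Definition Ycross (a b : A) : D0 :=
  \sum_(r <- msupp a) \sum_(s <- msupp b) \sum_(k < size (val s))
    \sum_(i < (size (val r)).+1) \sum_(j < (size (val r)).+1 | (i < j)%N)
      Yelt (ypair_of (i + k) (j + k))
        (mulA (cap (exp_add (xi i (2 ^ k)) (xi j (2 ^ k))) << a@_r *g r >>)
              (cap (xi k.+1 1) << b@_s *g s >>)).

Definition mulD (x y : D0) : D0 :=
  (milnor_mul x.1 y.1, 0) + Ycross (projD x) (projD y)
  + left_expand Yterm (projD x) y.2
  + (0, \sum_(p <- msupp x.2) << mulA (x.2@_p) (projD y) *g p >>).

(* The lift of a Steenrod word. *)
Definition wordD (w : seq nat) : D0 := foldr (fun n x => mulD (Sqt n) x) oneD w.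

(* D1 = A + mu_0 A + \sum_{k<l} U_{k,l} A, a free right A-module.  It is an
   A-bimodule, on which D0 acts through D0 -> A. *)

Definition D1 : zmodType := (A * A * {malg A[ypair]})%type.

Definition inA (a : A) : D1 := (a, 0, 0).
Definition mu0 (a : A) : D1 := (0, a, 0).
Definition Uelt (p : ypair) (a : A) : D1 := (0, 0, << a *g p >>).

(* U_{k,k} = mu_0 Sq(Delta_{k+1}) + Sq(2 Delta_k) and, for k > l,
   U_{k,l} = U_{l,k} + Sq(Delta_k + Delta_l).  In a U_{k,l} with k < l these only
   occur for positive indices. *)
Definition Uterm (k l : nat) (a : A) : D1 :=
  if k == l then mu0 (mulA (SqR (xi k.+1 1)) a) + inA (mulA (SqR (xi k 2)) a)
  else if (k < l)%N then Uelt (ypair_of k l) a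
  else Uelt (ypair_of k l) a + inA (mulA (SqR (exp_add (xi k 1) (xi l 1))) a).

(* a mu_0 = mu_0 a + kappa(a) *)
Definition lactD1 (a : A) (x : D1) : D1 :=
  inA (mulA a x.1.1) + (mu0 (mulA a x.1.2) + inA (mulA (kappa a) x.1.2))
  + left_expand Uterm a x.2.

Definition ractD1 (x : D1) (b : A) : D1 :=
  (mulA x.1.1 b, mulA x.1.2 b, \sum_(p <- msupp x.2) << mulA (x.2@_p) b *g p >>).

Definition boundary (x : D1) : D0 := twice x.1.2 + (0, x.2).

(* The Adem relation [a,b], lifted to D0; the binomials count mod 2. *)
Definition adem (a b : nat) : D0 :=
  mulD (Sqt a) (Sqt b)
  + \sum_(k < (a %/ 2).+1 | odd 'C(b - k - 1, a - 2 * k))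
      mulD (Sqt (a + b - k)%N) (Sqt k).

Definition adem_tracks (u : nat -> nat -> D1) : Prop :=
  forall (a b : nat), (0 < a)%N -> (a < 2 * b)%N -> forall alpha beta : seq nat,
  boundary (lactD1 (wordA alpha) (ractD1 (u a b) (wordA beta)))
  = mulD (mulD (wordD alpha) (adem a b)) (wordD beta).

(* The columns e_1, e_2, e_4, e_6, ..., named by their degrees. *)

Definition column : Type := {n : nat | (n == 1%N) || (0 < n)%N && ~~ odd n}.
HB.instance Definition _ := Choice.on column.

Definition col1 : column :=
  exist (fun n => is_true ((n == 1%N) || (0 < n)%N && ~~ odd n)) 1%N isT.
(* col n = e_n if n is 1 or even and positive; not used otherwise. *)
Definition col (n : nat) : column := insubd col1 n.

Definition F : zmodType := {malg A[column]}.
Definition FD : zmodType := {malg D0[column]}.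

Definition actF (a : A) (x : F) : F := \sum_(c <- msupp x) << mulA a (x@_c) *g c >>.

Definition homogF (n : nat) (x : F) : Prop :=
  forall c r, c \in msupp x -> r \in msupp (x@_c) -> (exp_deg (val r) + val c)%N = n.

Definition d1A (x : F) : A := \sum_(c <- msupp x) mulA (x@_c) (Sq (val c)).
Definition d1D (x : FD) : D0 := \sum_(c <- msupp x) mulD (x@_c) (Sqt (val c)).

Definition syzygy (n : nat) (x : F) : Prop := homogF n x /\ d1A x = 0.

(* Positive-degree elements form a left ideal, so the additive span of the
   multiples is already a submodule. *)
Inductive decomposable (n : nat) : F -> Prop :=
| decomposable0 : decomposable n 0
| decomposableD x y : decomposable n x -> decomposable n y -> decomposable n (x + y)
| decomposableM p a m x : (0 < p)%N -> homogA p a -> (m < n)%N -> syzygy m x ->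
    decomposable n (actF a x).

Definition indecomposable_syzygy (n : nat) (x : F) : Prop :=
  syzygy n x /\ ~ decomposable n x.

(* Sums of terms (Steenrod word) * e_c; only these, rather than elements of F,
   have a preferred lift to the free D0-module. *)
Definition word_sum := seq (seq nat * column).

Definition evalF (x : word_sum) : F := \sum_(t <- x) << wordA t.1 *g t.2 >>.
Definition liftF (x : word_sum) : FD := \sum_(t <- x) << wordD t.1 *g t.2 >>.

Definition is_track (h : D1) (x : word_sum) : Prop := boundary h = d1D (liftF x).

(* M_F is the summand of F on the even columns. *)
Definition in_MF (x : F) : Prop := x@_(col 1) = 0.
Definition even_part (x : F) : F := \sum_(c <- msupp x | c != col 1) << x@_c *g c >>.

Definition eq_mod_ASq1 (a b : A) : Prop := exists c : A, a - b = mulA c (Sq 1).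

(* nu, with values in A representing classes in A / A Sq^1 *)
Definition nu (x : F) : A := \sum_(c <- msupp x | c != col 1) mulA (x@_c) (Sq (val c)).

Definition in_KF (x : F) : Prop := in_MF x /\ eq_mod_ASq1 (nu x) 0.

Definition q2 : word_sum := [:: ([:: 1%N], col 1)].
Definition z4 : word_sum := [:: ([:: 2%N], col 2); ([:: 3%N], col 1)].
Definition z5 : word_sum :=
  [:: ([:: 2%N; 1%N], col 2); ([:: 1%N], col 4); ([:: 4%N], col 1)].
Definition rt6 : word_sum := [:: ([::], col 6); ([:: 2%N], col 4); ([:: 5%N], col 1)].
Definition z8 : word_sum :=
  [:: ([:: 6%N], col 2); ([:: 4%N], col 4); ([:: 2%N], col 6)].

Definition rho4 : word_sum := [:: ([:: 2%N], col 2)].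
Definition rho5 : word_sum := [:: ([:: 2%N; 1%N], col 2); ([:: 1%N], col 4)].
Definition r6 : word_sum := [:: ([::], col 6); ([:: 2%N], col 4)].
Definition rho8 : word_sum :=
  [:: ([:: 6%N], col 2); ([:: 4%N], col 4); ([:: 2%N], col 6)].

Definition representatives : seq (nat * word_sum) :=
  [:: (2%N, q2); (4%N, z4); (5%N, z5); (6%N, rt6); (8%N, z8)].

(* Main.v *)
(** All objects are finite in each degree.  After extending every operation
    additively from the Milnor basis, the assertions become finite computations.

    Tracks: [boundary] is additive and the relation tracks have prescribed
    boundaries, so each track identity is an equality of two explicit elements
    of [D0].

    Syzygies: in degree [n <= 8] all homogeneous elements are enumerated, and
    every syzygy is found to lie in the span of the representative of degree [n]
    and of Steenrod multiples of representatives of lower degree.  Conversely,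
    Milnor's product is graded, so only syzygies of degree [m < n] multiplied by
    elements of degree [n - m] can contribute to degree [n]; none of those
    products contains a certain monomial occurring in the representative. *)

From mathcomp Require Import all_boot all_order all_algebra.
From mathcomp Require Import finmap zify.
From mathcomp.multinomials Require Import monalg.
Require Import Defs.
Import GRing.Theory.
Set Implicit Arguments.
Unset Strict Implicit.
Unset Printing Implicit Defensive.
Local Open Scope ring_scope.

(** * Additive extension from a basis *)

Lemma morphD0 (V W : zmodType) (f : V -> W) : {morph f : x y / x + y} -> f 0 = 0.
Proof. by move=> fD; apply: (addIr (f 0)); rewrite -fD !add0r. Qed.

Lemma morphD_sum (V W : zmodType) (f : V -> W) (fD : {morph f : x y / x + y})
    (I : Type) (s : seq I) (P : pred I) (F : I -> V) :
  f (\sum_(i <- s | P i) F i) = \sum_(i <- s | P i) f (F i).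
Proof. exact: (big_morph f fD (morphD0 fD)). Qed.

Section LinearExtension.
Variables (K : choiceType) (G V : zmodType) (f : K -> G -> V).
Hypothesis fD : forall k, {morph f k : a b / a + b}.

(** The linear operations of the definitions are sums over [msupp], hence of this form by conversion
    or after moving a side condition into the summand. Bilinear ones are two nested copies. *)
Definition lin_ext (x : {malg G[K]}) : V := \sum_(k <- msupp x) f k x@_k.

(** Enlarging the support adds only terms [f k 0], which vanish by additivity; this allows sums over
    different supports to be compared over a common finite set. *)
Lemma lin_extEw (d : {fset K}) x :
  (msupp x `<=` d)%fset -> lin_ext x = \sum_(k <- d) f k x@_k.
Proof.
move=> le_xd; apply: big_fset_incl => // k _; rewrite -mcoeff_eq0 => /eqP ->.
exact: morphD0.
Qed.

Lemma lin_extD : {morph lin_ext : x y / x + y}.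
Proof.
move=> x y; rewrite (lin_extEw (msuppD_le x y)).
rewrite (lin_extEw (fsubsetUl (msupp x) (msupp y))).
rewrite (lin_extEw (fsubsetUr (msupp x) (msupp y))) -big_split /=.
by apply: eq_bigr => k _; rewrite mcoeffD fD.
Qed.

Lemma lin_extU k a : lin_ext << a *g k >> = f k a.
Proof. by rewrite (lin_extEw msuppU_le) big_seq_fset1 mcoeffUU. Qed.

End LinearExtension.

Section MilnorProduct.
Variable G : comNzRingType.
Implicit Types x y z : {malg G[milnor_exp]}.

Definition mul_basis (r : milnor_exp) (a : G) (s : milnor_exp) (b : G) :
    {malg G[milnor_exp]} :=
  \sum_(X <- milnor_interiors (val r) (val s))
    << a * b * (milnor_coef (val r) (val s) X)%:R
       *g mexp (milnor_exponent (val r) (val s) X) >>.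

Lemma mul_basisDr r a s : {morph mul_basis r a s : b c / b + c}.
Proof.
move=> b c; rewrite /mul_basis -big_split /=; apply: eq_bigr => X _.
by rewrite mulrDr mulrDl monalgUD.
Qed.

Lemma mul_basisDl r s b : {morph (fun a => mul_basis r a s b) : a c / a + c}.
Proof.
move=> a c; rewrite /mul_basis -big_split /=; apply: eq_bigr => X _.
by rewrite !mulrDl monalgUD.
Qed.

Lemma milnor_mulE x y :
  milnor_mul x y = lin_ext (fun r a => lin_ext (mul_basis r a) y) x.
Proof. by []. Qed.

Lemma milnor_mul_fstD y r :
  {morph (fun a => lin_ext (mul_basis r a) y) : a b / a + b}.
Proof.
move=> a b; rewrite /lin_ext -big_split /=; apply: eq_bigr => s _.
exact: mul_basisDl.
Qed.

Lemma milnor_mulDl y : {morph (@milnor_mul G)^~ y : x z / x + z}.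
Proof. exact: lin_extD (milnor_mul_fstD y). Qed.

Lemma milnor_mulDr x : {morph milnor_mul x : y z / y + z}.
Proof.
move=> y z; rewrite !milnor_mulE /lin_ext -big_split /=; apply: eq_bigr => r _.
exact: (lin_extD (@mul_basisDr _ _)).
Qed.

Lemma milnor_mulUU r a s b :
  milnor_mul << a *g r >> << b *g s >> = mul_basis r a s b.
Proof.
rewrite milnor_mulE (lin_extU (milnor_mul_fstD _)).
exact: (lin_extU (@mul_basisDr _ _)).
Qed.

End MilnorProduct.

Definition mulADl b : {morph mulA^~ b : x z / x + z} := milnor_mulDl b.
Definition mulADr a : {morph mulA a : x z / x + z} := milnor_mulDr a.
Lemma mulA0 a : mulA a 0 = 0. Proof. exact: morphD0 (mulADr a). Qed.
Lemma mul0A a : mulA 0 a = 0. Proof. exact: morphD0 (mulADl a). Qed.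

(** * Canonical exponent sequences and the unit of the Steenrod algebra *)

Lemma trim_cons x r :
  trim (x :: r) = if (x == 0%N) && nilp (trim r) then [::] else x :: trim r.
Proof. by []. Qed.

Lemma trim_eq (p r : seq nat) : (forall i, nth 0%N p i = nth 0%N r i) -> trim p = trim r.
Proof.
elim: p r => [|a p IH] r.
  elim: r => //= b r IHr pr; rewrite -IHr.
    by have /= <- := pr 0%N.
  by move=> i; have := pr i.+1; rewrite /= nth_nil.
case: r => [|b r] pr /=.
  rewrite (IH [::]) /=; last by move=> i; have := pr i.+1; rewrite /= nth_nil.
  by have /= -> := pr 0%N.
by rewrite (IH r); [have /= -> := pr 0%N | move=> i; have := pr i.+1].
Qed.

Lemma trim_id (r : seq nat) : last 1%N r != 0%N -> trim r = r.
Proof.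
elim: r => // x r IH; rewrite trim_cons; case: r IH => [_|y r IH] l0.
  by rewrite /= andbT (negPf l0).
by rewrite IH // andbF.
Qed.

Lemma mexp_val (r : milnor_exp) : mexp (val r) = r.
Proof. by apply: val_inj; rewrite /= trim_id //; apply: (valP r). Qed.

Lemma nth_trim r i : nth 0%N (trim r) i = nth 0%N r i.
Proof.
elim: r i => // x r IH [|i]; rewrite trim_cons /=; case: ifP => //= /andP[/eqP x0 nr].
  by rewrite x0.
by rewrite -IH (nilP nr) nth_nil.
Qed.

Lemma multinomial_rcons n c : multinomial (rcons (nseq n 0%N) c) = 1%N.
Proof.
by elim: n => /= [|n IH]; rewrite ?addn0 ?binn // bin0 mul1n.
Qed.

Lemma sumn_rcons_nseq n c : sumn (rcons (nseq n 0%N) c) = c.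
Proof. by elim: n => //=; rewrite addn0. Qed.

Lemma mkseq_rcons (f : nat -> nat) k :
  (forall i, (i < k)%N -> f i = 0%N) -> mkseq f k.+1 = rcons (nseq k 0%N) (f k).
Proof.
move=> f0; apply: (@eq_from_nth _ 0%N); first by rewrite size_mkseq size_rcons size_nseq.
rewrite size_mkseq => i lik; rewrite nth_mkseq // nth_rcons size_nseq nth_nseq.
move: lik; rewrite ltnS leq_eqVlt => /predU1P[->|lik]; first by rewrite ltnn eqxx.
by rewrite lik f0.
Qed.

Lemma mkseq_cons (f : nat -> nat) k :
  (forall i, (i < k)%N -> f i.+1 = 0%N) -> mkseq f k.+1 = f 0%N :: nseq k 0%N.
Proof.
move=> f0; apply: (@eq_from_nth _ 0%N); first by rewrite size_mkseq /= size_nseq.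
rewrite size_mkseq => -[|i] lik; rewrite nth_mkseq //= nth_nseq.
by rewrite ltnS in lik; rewrite f0 // lik.
Qed.

Lemma multinomial_cons n c : multinomial (c :: nseq n 0%N) = 1%N.
Proof.
have s0: sumn (nseq n 0%N) = 0%N by elim: n.
by rewrite /= s0 addn0 binn mul1n; elim: n {s0} => //= n ->; rewrite muln1 bin0.
Qed.

Lemma foldr_mul1 (f : nat -> nat) s : (forall k, k \in s -> f k = 1%N) ->
  foldr (fun k c => f k * c)%N 1%N s = 1%N.
Proof.
elim: s => //= k s IH f1; rewrite f1 ?mem_head // IH // => i si.
by rewrite f1 // in_cons si orbT.
Qed.

(** With no rows below row 0, an antidiagonal can be nonzero only at its first position, which lies
    in row 0. *)
Lemma milnor_diag0l s k : milnor_diag [::] s [::] k.+1 = nth 0%N s k :: nseq k.+1 0%N.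
Proof.
rewrite /milnor_diag mkseq_cons => [|i _].
  by rewrite /= /col_weight /= subn0.
rewrite /= /milnor_entry; case: (_ - _)%N => [|j]; rewrite ?nth_nil //.
by rewrite /interior !nth_nil.
Qed.

(** Symmetrically, only column 0 survives, and it meets an antidiagonal at its last position. *)
Lemma milnor_diag0r r n k :
  milnor_diag r [::] (nseq n [::]) k.+1 = rcons (nseq k.+1 0%N) (nth 0%N r k).
Proof.
rewrite /milnor_diag mkseq_rcons => [|i li].
  by rewrite /= subnn /row_weight /= subn0.
rewrite subSn // /milnor_entry; case: i {li} => [|i]; first by rewrite nth_nil.
by rewrite /interior nth_nseq; case: ifP => _; rewrite ?nth_nil.
Qed.

Lemma interiors0l s : milnor_interiors [::] s = [:: [::]].
Proof.
rewrite /milnor_interiors /=; rewrite ifT //.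
by apply/allP => j _; rewrite /col_weight.
Qed.

Lemma interiors0r r : milnor_interiors r [::] = [:: nseq (size r) [::]].
Proof.
rewrite /milnor_interiors.
have -> : matrices_below (size r) [::] = [:: nseq (size r) [::]].
  by elim: (size r) => //= n ->.
by rewrite /= ifT // andbT; apply/allP => j _; rewrite /row_weight.
Qed.

(** There is a single Milnor matrix, with empty interior; each of its antidiagonals has at most one
    nonzero entry, so all multinomial coefficients are 1. *)
Lemma mulA1l a : mulA oneA a = a.
Proof.
rewrite [in RHS](monalgE a) {1}(monalgE a) (morphD_sum (mulADr _)).
apply: eq_bigr => s _; rewrite [LHS]milnor_mulUU /mul_basis interiors0l big_seq1.
have -> : milnor_coef [::] (val s) [::] = 1%N.
  apply: foldr_mul1 => -[|k]; rewrite mem_iota // => _.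
  by rewrite milnor_diag0l multinomial_cons.
rewrite mul1r mulr1; congr << _ *g _ >>; rewrite -[RHS]mexp_val; apply: val_inj.
apply: trim_eq => i /=; have [lt|ge] := ltnP i (size (val s)); last first.
  by rewrite !nth_default // size_mkseq.
rewrite nth_mkseq // milnor_diag0l /=.
by rewrite [sumn _](_ : _ = 0%N) ?addn0 //; elim: (i).
Qed.

Lemma mulA1r a : mulA a oneA = a.
Proof.
rewrite [in RHS](monalgE a) {1}(monalgE a) (morphD_sum (mulADl _)).
apply: eq_bigr => r _; rewrite [LHS]milnor_mulUU /mul_basis interiors0r big_seq1.
have -> : milnor_coef (val r) [::] (nseq (size (val r)) [::]) = 1%N.
  apply: foldr_mul1 => -[|k]; rewrite mem_iota // => _.
  by rewrite milnor_diag0r multinomial_rcons.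
rewrite !mulr1; congr << _ *g _ >>; rewrite -[RHS]mexp_val; apply: val_inj.
apply: trim_eq => i /=; have [lt|ge] := ltnP i (size (val r)); last first.
  by rewrite !nth_default // size_mkseq addn0.
by rewrite nth_mkseq ?addn0 // milnor_diag0r sumn_rcons_nseq.
Qed.

(** * The Milnor product on lists of terms *)

(* (c, r) stands for c Sq(r). *)
Definition term : Type := (nat * seq nat)%type.

Definition ev (G : comNzRingType) (x : seq term) : {malg G[milnor_exp]} :=
  \sum_(t <- x) << t.1%:R *g mexp t.2 >>.

(** Reducing modulo [q] and dropping zero terms at once keeps the lists short during evaluation. The
    exponents returned need not be canonical, since [ev] trims them. *)
Definition mul_terms (q : nat) (t s : term) : seq term :=
  [seq t' <- [seq (t.1 * s.1 * milnor_coef (trim t.2) (trim s.2) X %% q,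
                  milnor_exponent (trim t.2) (trim s.2) X)%N
             | X <- milnor_interiors (trim t.2) (trim s.2)] | t'.1 != 0%N].

Definition mul_list (q : nat) (x y : seq term) : seq term :=
  [seq t | p <- [seq (t, s) | t <- x, s <- y], t <- mul_terms q p.1 p.2].

Lemma natr_mod (G : comNzRingType) q n : q%:R = 0 :> G -> (n %% q)%:R = n%:R :> G.
Proof. by move=> q0; rewrite [in RHS](divn_eq n q) natrD natrM q0 mulr0 add0r. Qed.

Section Ev.
Variable G : comNzRingType.
Local Notation evG := (ev G).

Lemma ev1 t : evG [:: t] = << t.1%:R *g mexp t.2 >>.
Proof. exact: big_seq1. Qed.

Lemma ev_cat x y : evG (x ++ y) = evG x + evG y.
Proof. exact: big_cat. Qed.

Lemma evE x : evG x = \sum_(t <- x) evG [:: t].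
Proof. by apply: eq_bigr => t _; rewrite ev1. Qed.

Lemma ev_allpairs (I J : Type) (h : I -> J -> term) s (t : I -> seq J) :
  evG [seq h i j | i <- s, j <- t i] = \sum_(i <- s) evG [seq h i j | j <- t i].
Proof. by rewrite /ev big_allpairs_dep; under [RHS]eq_bigr do rewrite big_map. Qed.

Lemma ev_mul_terms q t s : q%:R = 0 :> G ->
  evG (mul_terms q t s) = milnor_mul (evG [:: t]) (evG [:: s]).
Proof.
move=> q0; rewrite !ev1 milnor_mulUU /mul_basis /ev big_filter big_map big_mkcond /=.
apply: eq_bigr => X _; set c := (_ * milnor_coef _ _ X)%N.
have -> : t.1%:R * s.1%:R * (milnor_coef (trim t.2) (trim s.2) X)%:R = (c %% q)%:R :> G.
  by rewrite natr_mod // !natrM.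
by case: eqP => // ->; rewrite monalgU0.
Qed.

Lemma ev_mul q x y : q%:R = 0 :> G ->
  evG (mul_list q x y) = milnor_mul (evG x) (evG y).
Proof.
move=> q0; rewrite ev_allpairs big_allpairs_dep [evG x]evE (morphD_sum (milnor_mulDl _)).
apply: eq_bigr => t _; rewrite [evG y]evE (morphD_sum (milnor_mulDr _)).
by apply: eq_bigr => s _; rewrite map_id ev_mul_terms.
Qed.

Definition coef_list (x : seq term) (r : seq nat) : nat :=
  sumn [seq t.1 | t <- x & trim t.2 == trim r].

Lemma coef_ev x r : (evG x)@_(mexp r) = (coef_list x r)%:R.
Proof.
elim: x => [|t x IH]; first by rewrite /ev big_nil mcoeff0.
rewrite -cat1s ev_cat mcoeffD IH ev1 mcoeffU /coef_list /= -val_eqE /=.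
by case: eqP => _ /=; rewrite ?natrD // add0r.
Qed.

(** Like terms are never collected, so vanishing is tested on the total coefficient of each exponent
    that occurs in the list. *)
Definition is_zero (q : nat) (x : seq term) := all (fun t => q %| coef_list x t.2)%N x.

Lemma ev_is_zero q x : q%:R = 0 :> G -> is_zero q x -> evG x = 0.
Proof.
move=> q0 /allP z; apply/malgP => r; rewrite mcoeff0 -(mexp_val r) coef_ev.
suff /dvdnP[n ->] : (q %| coef_list x (val r))%N by rewrite natrM q0 mulr0.
case: (boolP (has (fun t => trim t.2 == trim (val r)) x)) => [/hasP[t tx /eqP tr]|].
  by have := z t tx; rewrite /coef_list tr.
by rewrite has_filter negbK /coef_list => /eqP ->.
Qed.

End Ev.

Lemma pchar_F2 : 2%:R = 0 :> 'F_2. Proof. exact/eqP. Qed.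
Lemma pchar_Z4 : 4%:R = 0 :> 'Z_4. Proof. exact/eqP. Qed.

Definition evA (x : seq term) : A := ev 'F_2 x.

Lemma evA_cat x y : evA (x ++ y) = evA x + evA y. Proof. exact: ev_cat. Qed.
Lemma evAE x : evA x = \sum_(t <- x) evA [:: t]. Proof. exact: evE. Qed.
Lemma evA_mul x y : evA (mul_list 2 x y) = mulA (evA x) (evA y).
Proof. exact/ev_mul/pchar_F2. Qed.

Definition cap_basis (p : seq nat) (r : milnor_exp) (c : 'F_2) : A :=
  if exp_le p (val r) then << c *g mexp (exp_sub (val r) p) >> else 0.

Lemma cap_basisD p r : {morph cap_basis p r : c d / c + d}.
Proof. by move=> c d; rewrite /cap_basis; case: ifP; rewrite ?monalgUD ?addr0. Qed.

Lemma capE p a : cap p a = lin_ext (cap_basis p) a.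
Proof. exact: big_mkcond. Qed.

Lemma capD p : {morph cap p : a b / a + b}.
Proof. by move=> a b; rewrite !capE (lin_extD (@cap_basisD p)). Qed.

Lemma capUD p r : {morph (fun c => cap p << c *g r >>) : c d / c + d}.
Proof. by move=> c d; rewrite monalgUD capD. Qed.

Definition cap_list (p : seq nat) (x : seq term) : seq term :=
  [seq (t.1, exp_sub (trim t.2) p) | t <- x & exp_le p (trim t.2)].

Lemma evA_cap p x : evA (cap_list p x) = cap p (evA x).
Proof.
rewrite [evA x]evAE (morphD_sum (capD p)) /evA {1}/ev big_map big_filter big_mkcond.
by apply: eq_bigr => t _; rewrite ev1 capE (lin_extU (@cap_basisD p)).
Qed.

(** * Lists for free modules over the Steenrod algebra and for D0 *)

Section Nested.
Variables (J : eqType) (K : choiceType) (key : J -> K).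

(** The codes [J] compute, whereas the keys [K] are subtypes. This serves both the Y-part of [D0],
    with pairs of indices, and [F], with column numbers. *)
Definition evK (x : seq (J * term)) : {malg A[K]} :=
  \sum_(t <- x) << evA [:: t.2] *g key t.1 >>.

Lemma evK_cat x y : evK (x ++ y) = evK x + evK y.
Proof. exact: big_cat. Qed.

Lemma evK_const j x : evK [seq (j, t) | t <- x] = << evA x *g key j >>.
Proof.
rewrite /evK big_map evAE; elim: x => [|t x IH]; first by rewrite !big_nil monalgU0.
by rewrite !big_cons monalgUD IH.
Qed.

Lemma evK_allpairs (I : Type) (k : I -> J) s (F : I -> seq term) :
  evK [seq (k i, t) | i <- s, t <- F i] = \sum_(i <- s) << evA (F i) *g key (k i) >>.
Proof.
by rewrite /evK big_allpairs_dep; apply: eq_bigr => i _; rewrite -evK_const /evK big_map.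
Qed.

(** Terms are grouped by code rather than by key, so a positive answer is sound for any [key],
    injective or not. *)
Definition is_zeroK (x : seq (J * term)) :=
  all (fun j => is_zero 2 [seq t.2 | t <- x & t.1 == j]) (undup [seq t.1 | t <- x]).

Lemma evK_is_zero x : is_zeroK x -> evK x = 0.
Proof.
move=> /allP z.
have -> : evK x = \sum_(j <- undup [seq t.1 | t <- x])
                    evK [seq t <- x | t.1 == j].
  rewrite /evK; under [RHS]eq_bigr do rewrite big_filter big_mkcond.
  rewrite exchange_big /= !big_seq; apply: eq_bigr => t tx.
  rewrite (bigD1_seq t.1) ?undup_uniq ?mem_undup ?map_f //= eqxx big1 ?addr0 // => j.
  by rewrite eq_sym => /negPf ->.
rewrite big_seq big1 // => j /z zj.
have -> : [seq t <- x | t.1 == j]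
        = [seq (j, t) | t <- [seq t.2 | t <- x & t.1 == j]].
  rewrite -map_comp -[LHS]map_id; apply/eq_in_map => -[i t].
  by rewrite mem_filter /= => /andP[/eqP ->].
by rewrite evK_const /evA (ev_is_zero pchar_F2 zj) monalgU0.
Qed.

End Nested.

Definition D0_list : Type := (seq term * seq ((nat * nat) * term))%type.

Definition ykey (p : nat * nat) : ypair := insubd ypair01 p.
Definition evD (x : D0_list) : D0 := (ev 'Z_4 x.1, evK ykey x.2).

Definition D0_add (x y : D0_list) : D0_list := (x.1 ++ y.1, x.2 ++ y.2).

Lemma evD_add x y : evD (D0_add x y) = evD x + evD y.
Proof. by rewrite /evD ev_cat evK_cat. Qed.

Definition D0_sum (I : Type) (s : seq I) (F : I -> D0_list) : D0_list :=
  foldr (fun i => D0_add (F i)) ([::], [::]) s.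

Lemma evD_sum (I : Type) (s : seq I) (F : I -> D0_list) :
  evD (D0_sum s F) = \sum_(i <- s) evD (F i).
Proof.
elim: s => [|i s IH] /=; first by rewrite /evD /ev /evK !big_nil.
by rewrite evD_add IH big_cons.
Qed.

Lemma evD_sum_ord n (P : pred nat) (F : nat -> D0_list) :
  evD (D0_sum [seq i <- iota 0 n | P i] F) = \sum_(i < n | P i) evD (F i).
Proof.
by rewrite evD_sum big_filter -[n in iota _ n]subn0 -/(index_iota 0 n) big_mkord.
Qed.

Lemma evD_sum_iota n (F : nat -> D0_list) :
  evD (D0_sum (iota 0 n) F) = \sum_(i < n) evD (F i).
Proof. by rewrite -(evD_sum_ord _ xpredT) filter_predT. Qed.

Definition D0_Y (k l : nat) (x : seq term) : D0_list :=
  ([::], [seq ((minn k l, maxn k l), t) | t <- x]).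

Lemma YeltD p : {morph Yelt p : a b / a + b}.
Proof. by move=> a b; rewrite /Yelt monalgUD; congr pair; rewrite addr0. Qed.

Lemma evD_Y k l x : evD (D0_Y k l x) = Yelt (ypair_of k l) (evA x).
Proof. by rewrite /evD /= evK_const /ev big_nil. Qed.

Definition twice_basis (r : milnor_exp) (c : 'F_2) : {malg 'Z_4[milnor_exp]} :=
  << (2 * val c)%:R *g r >>.

(** The lift [val] from Z/2 to Z/4 is not additive, but its double is: 2 (1 + 1) vanishes on both
    sides. The four cases are inspected. *)
Lemma twice_basisD r : {morph twice_basis r : c d / c + d}.
Proof.
move=> c d; rewrite /twice_basis -monalgUD; congr << _ *g _ >>.
rewrite -natrD -mulnDr /=; apply/val_inj => /=.
by case: c d => [[|[|c]] hc] [[|[|d]] hd].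
Qed.

Lemma twiceD : {morph twice : a b / a + b}.
Proof.
move=> a b; rewrite /twice -!/(lin_ext twice_basis _) (lin_extD twice_basisD).
by congr pair; rewrite addr0.
Qed.

Definition D0_twice (x : seq term) : D0_list := ([seq (2 * t.1, t.2)%N | t <- x], [::]).

Lemma evD_twice x : evD (D0_twice x) = twice (evA x).
Proof.
rewrite evAE (morphD_sum twiceD).
transitivity (\sum_(t <- x) ((<< (2 * t.1)%:R *g mexp t.2 >>, 0) : D0)).
  elim: x => [|t x IH]; first by rewrite /evD /ev /evK !big_nil.
  rewrite big_cons -IH /evD /= -(cat1s (_, _)) ev_cat ev1.
  by congr pair; rewrite add0r.
apply: eq_bigr => t _; rewrite /evA ev1 /twice -/(lin_ext twice_basis _).
rewrite (lin_extU twice_basisD) /twice_basis; congr (<< _ *g _ >>, _).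
have -> : \val (t.1%:R : 'F_2) = (t.1 %% 2)%N by rewrite -val_Fp_nat.
(* 2 t = 4 (t %/ 2) + 2 (t %% 2), and the first summand is zero in Z/4. *)
rewrite {1}(divn_eq t.1 2) mulnDr natrD mulnCA (natrM _ (_ %/ _)%N 4) pchar_Z4.
by rewrite mulr0 add0r.
Qed.

(** * The product of D0 *)

Lemma YtermD k l : {morph Yterm k l : a b / a + b}.
Proof.
by move=> a b; rewrite /Yterm; case: eqP => _; rewrite ?mulADr ?twiceD ?YeltD.
Qed.

Definition D0_Yterm (k l : nat) (x : seq term) : D0_list :=
  if k == l then D0_twice (mul_list 2 [:: (1, xi k.+1 1)]%N x) else D0_Y k l x.

Lemma evD_Yterm k l x : evD (D0_Yterm k l x) = Yterm k l (evA x).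
Proof.
rewrite /D0_Yterm /Yterm; case: eqP => _; last exact: evD_Y.
by rewrite evD_twice evA_mul [X in mulA X]ev1.
Qed.

Definition proj_basis (r : milnor_exp) (c : 'Z_4) : {malg 'F_2[milnor_exp]} :=
  << (val c)%:R *g r >>.

Lemma proj_basisD r : {morph proj_basis r : c d / c + d}.
Proof.
move=> c d; rewrite /proj_basis -monalgUD -natrD -(natr_mod _ pchar_F2).
rewrite -[in RHS](natr_mod _ pchar_F2); congr << _%:R *g _ >>.
by rewrite /= modn_dvdm.
Qed.

Lemma projAE x : projA x = lin_ext proj_basis x.
Proof. by []. Qed.

Lemma projAD : {morph projA : x y / x + y}.
Proof. by move=> x y; rewrite !projAE (lin_extD proj_basisD). Qed.

Lemma projA_ev x : projA (ev 'Z_4 x) = evA x.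
Proof.
rewrite /ev (morphD_sum projAD); apply: eq_bigr => t _.
rewrite projAE (lin_extU proj_basisD); congr << _ *g _ >>.
rewrite -(natr_mod _ pchar_F2) -[RHS](natr_mod _ pchar_F2); congr _%:R.
by rewrite -[LHS]/((t.1%:R : 'Z_4) %% 2)%N val_Zp_nat // modn_dvdm.
Qed.

Section LeftExpand.
Variables (V : zmodType) (T : nat -> nat -> A -> V).
Hypothesis TD : forall k l, {morph T k l : a b / a + b}.

(** [T] stays abstract because the same expansion is used with [Yterm] for [D0] and with [Uterm] for
    [D1]. *)
Definition expand_basis (p : ypair) (b : A) (r : milnor_exp) (c : 'F_2) : V :=
  \sum_(i < (size (val r)).+1) \sum_(j < (size (val r)).+1)
    T ((val p).1 + i)%N ((val p).2 + j)%N
      (mulA (cap (exp_add (xi i (2 ^ (val p).1)) (xi j (2 ^ (val p).2)))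
                 << c *g r >>) b).

Lemma expand_basisDr p b r : {morph expand_basis p b r : c d / c + d}.
Proof.
move=> c d; rewrite /expand_basis -big_split; apply: eq_bigr => i _ /=.
by rewrite -big_split; apply: eq_bigr => j _; rewrite capUD mulADl TD.
Qed.

Lemma expand_basisDl p r c : {morph (fun b => expand_basis p b r c) : a b / a + b}.
Proof.
move=> a b; rewrite /expand_basis -big_split; apply: eq_bigr => i _ /=.
by rewrite -big_split; apply: eq_bigr => j _; rewrite mulADr TD.
Qed.

Lemma expand_sumD a p : {morph (fun b => lin_ext (expand_basis p b) a) : b c / b + c}.
Proof.
by move=> b c; rewrite /lin_ext -big_split; apply: eq_bigr => r _; rewrite expand_basisDl.
Qed.

Lemma left_expandE a y :
  left_expand T a y = lin_ext (fun p b => lin_ext (expand_basis p b) a) y.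
Proof. by []. Qed.

Lemma left_expandDl y : {morph (fun a => left_expand T a y) : a b / a + b}.
Proof.
move=> a b; rewrite !left_expandE /lin_ext -big_split; apply: eq_bigr => p _.
exact: lin_extD (@expand_basisDr _ _) _ _.
Qed.

Lemma left_expandDr a : {morph left_expand T a : y z / y + z}.
Proof. by move=> y z; rewrite !left_expandE (lin_extD (expand_sumD a)). Qed.

Lemma left_expandUU r c p b :
  left_expand T << c *g r >> << b *g p >> = expand_basis p b r c.
Proof.
rewrite left_expandE (lin_extU (expand_sumD _)).
exact: lin_extU (@expand_basisDr _ _) _ _.
Qed.

End LeftExpand.

(** The local [p] reproduces the default pair of [ykey] in a form that computes. *)
Definition D0_expand (x : seq term) (y : seq ((nat * nat) * term)) : D0_list :=
  D0_sum y (fun s => D0_sum x (fun t =>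
    let p := if (s.1.1 < s.1.2)%N then s.1 else (0, 1)%N in
    D0_sum (iota 0 (size (trim t.2)).+1) (fun i =>
    D0_sum (iota 0 (size (trim t.2)).+1) (fun j =>
      D0_Yterm (p.1 + i) (p.2 + j)
        (mul_list 2 (cap_list (exp_add (xi i (2 ^ p.1)) (xi j (2 ^ p.2))) [:: t])
                [:: s.2]))))).

Lemma val_ykey p : val (ykey p) = if (p.1 < p.2)%N then p else (0, 1)%N.
Proof. exact: val_insubd. Qed.

Lemma evD_expand x y :
  evD (D0_expand x y) = left_expand Yterm (evA x) (evK ykey y).
Proof.
rewrite evD_sum /evK (morphD_sum (left_expandDr YtermD _)).
apply: eq_bigr => s _; rewrite evD_sum [evA x]evAE.
rewrite (morphD_sum (left_expandDl YtermD _)); apply: eq_bigr => t _.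
rewrite /evA !ev1 (left_expandUU YtermD) -val_ykey; cbv zeta; rewrite evD_sum_iota.
apply: eq_bigr => i _; rewrite evD_sum_iota; apply: eq_bigr => j _.
by rewrite evD_Yterm evA_mul evA_cap /evA !ev1.
Qed.

Definition cross_basis (r : milnor_exp) (c : 'F_2) (s : milnor_exp) (d : 'F_2) : D0 :=
  \sum_(k < size (val s))
    \sum_(i < (size (val r)).+1) \sum_(j < (size (val r)).+1 | (i < j)%N)
      Yelt (ypair_of (i + k) (j + k))
        (mulA (cap (exp_add (xi i (2 ^ k)) (xi j (2 ^ k))) << c *g r >>)
              (cap (xi k.+1 1) << d *g s >>)).

Lemma cross_basisDl r s d : {morph (fun c => cross_basis r c s d) : c c' / c + c'}.
Proof.
move=> c c'; rewrite /cross_basis -big_split; apply: eq_bigr => k _ /=.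
rewrite -big_split; apply: eq_bigr => i _ /=.
by rewrite -big_split; apply: eq_bigr => j _ /=; rewrite capUD mulADl YeltD.
Qed.

Lemma cross_basisDr r c s : {morph cross_basis r c s : d d' / d + d'}.
Proof.
move=> d d'; rewrite /cross_basis -big_split; apply: eq_bigr => k _ /=.
rewrite -big_split; apply: eq_bigr => i _ /=.
by rewrite -big_split; apply: eq_bigr => j _ /=; rewrite capUD mulADr YeltD.
Qed.

Lemma YcrossE a b :
  Ycross a b = lin_ext (fun r c => lin_ext (cross_basis r c) b) a.
Proof. by []. Qed.

Lemma cross_sumD b r : {morph (fun c => lin_ext (cross_basis r c) b) : c d / c + d}.
Proof.
by move=> c d; rewrite /lin_ext -big_split; apply: eq_bigr => s _; rewrite cross_basisDl.
Qed.

Lemma YcrossDl b : {morph Ycross^~ b : a c / a + c}.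
Proof. by move=> a c; rewrite !YcrossE (lin_extD (cross_sumD b)). Qed.

Lemma YcrossDr a : {morph Ycross a : b c / b + c}.
Proof.
move=> b c; rewrite !YcrossE /lin_ext -big_split; apply: eq_bigr => r _.
exact: lin_extD (@cross_basisDr _ _) _ _.
Qed.

Lemma YcrossUU r c s d : Ycross << c *g r >> << d *g s >> = cross_basis r c s d.
Proof.
rewrite YcrossE (lin_extU (cross_sumD _)).
exact: lin_extU (@cross_basisDr _ _) _ _.
Qed.

Definition D0_cross (x y : seq term) : D0_list :=
  D0_sum x (fun t => D0_sum y (fun s =>
    D0_sum (iota 0 (size (trim s.2))) (fun k =>
    let n := (size (trim t.2)).+1 in
    D0_sum (iota 0 n) (fun i => D0_sum [seq j <- iota 0 n | (i < j)%N] (fun j =>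
      D0_Y (i + k) (j + k)
        (mul_list 2 (cap_list (exp_add (xi i (2 ^ k)) (xi j (2 ^ k))) [:: t])
                (cap_list (xi k.+1 1) [:: s]))))))).

Lemma evD_cross x y : evD (D0_cross x y) = Ycross (evA x) (evA y).
Proof.
rewrite evD_sum [evA x]evAE (morphD_sum (YcrossDl _)).
apply: eq_bigr => t _; rewrite evD_sum [evA y]evAE (morphD_sum (YcrossDr _)).
apply: eq_bigr => s _; rewrite /evA !ev1 YcrossUU evD_sum_iota.
apply: eq_bigr => k _; rewrite evD_sum_iota; apply: eq_bigr => i _.
rewrite (evD_sum_ord _ (fun j => i < j)%N); apply: eq_bigr => j _.
by rewrite evD_Y evA_mul !evA_cap /evA !ev1.
Qed.

Definition D0_mul (x y : D0_list) : D0_list :=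
  D0_add (D0_add (D0_add (mul_list 4 x.1 y.1, [::]) (D0_cross x.1 y.1))
                 (D0_expand x.1 y.2))
    ([::], [seq (s.1, t) | s <- x.2, t <- mul_list 2 [:: s.2] y.1]).

Lemma rmulD (x : A) p :
  {morph (fun b : A => << mulA b x *g p >> : {malg A[ypair]}) : b c / b + c}.
Proof. by move=> b c; rewrite mulADl monalgUD. Qed.

Lemma evD_mul x y : evD (D0_mul x y) = mulD (evD x) (evD y).
Proof.
have e1 : evD (mul_list 4 x.1 y.1, [::]) = (milnor_mul (evD x).1 (evD y).1, 0).
  by rewrite /evD /= (ev_mul _ _ pchar_Z4) /evK big_nil.
have e2 : evD ([::], [seq (s.1, t) | s <- x.2, t <- mul_list 2 [:: s.2] y.1])
    = (0, \sum_(p <- msupp (evD x).2) << mulA ((evD x).2@_p) (evA y.1) *g p >>).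
  rewrite /evD /= evK_allpairs [ev _ [::]]big_nil; congr (_, _).
  rewrite -[RHS]/(lin_ext (fun p b => << mulA b (evA y.1) *g p >>) _) /evK.
  rewrite (morphD_sum (lin_extD (@rmulD _))); apply: eq_bigr => s _.
  by rewrite (lin_extU (@rmulD _)) evA_mul.
rewrite /D0_mul !evD_add e1 e2 evD_cross evD_expand.
by rewrite /mulD /projD -!projA_ev.
Qed.

(** This is the additivity that [d1D] calls for: there the module coefficient is the left factor. *)
Lemma mulD_additive z : {morph mulD^~ z : x y / x + y}.
Proof.
move=> x y; rewrite /mulD /projD projAD YcrossDl (left_expandDl YtermD).
have pairDl a b : ((a + b, 0) : D0) = (a, 0) + (b, 0) by congr pair; rewrite addr0.
have pairDr a b : ((0, a + b) : D0) = (0, a) + (0, b) by congr pair; rewrite addr0.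
rewrite milnor_mulDl pairDl.
rewrite -!/(lin_ext (fun p b => << mulA b (projA z.1) *g p >>) _).
rewrite (lin_extD (@rmulD _)) pairDr.
(* The eight summands alternate between [x] and [y]; they are sorted into two groups of four. *)
by rewrite [LHS](AC ((2*2)*2*2) (((1*3)*5*7)*((2*4)*6*8))).
Qed.

(** * Boundaries of tracks *)

Definition D0_Sq (n : nat) : D0_list := ([:: (1, [:: n])]%N, [::]).
Definition D0_one : D0_list := ([:: (1, [::])]%N, [::]).
Definition D0_word (w : seq nat) : D0_list := foldr (fun n => D0_mul (D0_Sq n)) D0_one w.
Definition D0_adem (a b : nat) : D0_list :=
  D0_add (D0_mul (D0_Sq a) (D0_Sq b))
    (D0_sum [seq k <- iota 0 (a %/ 2).+1 | odd 'C(b - k - 1, a - 2 * k)]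
       (fun k => D0_mul (D0_Sq (a + b - k)%N) (D0_Sq k))).

Lemma evD_Sq n : evD (D0_Sq n) = Sqt n.
Proof. by rewrite /evD /= ev1 /evK big_nil. Qed.

Lemma evD_one : evD D0_one = oneD.
Proof. by rewrite /evD /= ev1 /evK big_nil. Qed.

Lemma evD_word w : evD (D0_word w) = wordD w.
Proof. by elim: w => [|n w IH] /=; rewrite ?evD_one // evD_mul IH evD_Sq. Qed.

Lemma evD_adem a b : evD (D0_adem a b) = adem a b.
Proof.
rewrite /D0_adem evD_add evD_mul !evD_Sq /adem evD_sum_ord.
by congr (_ + _); apply: eq_bigr => k _; rewrite evD_mul !evD_Sq.
Qed.

Definition word_list (w : seq nat) : seq term :=
  foldr (fun n => mul_list 2 [:: (1, [:: n])]%N) [:: (1, [::])]%N w.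

Lemma evA_word w : evA (word_list w) = wordA w.
Proof.
by elim: w => [|n w IH] /=; rewrite ?evA_mul ?IH /evA ev1.
Qed.

Definition wsum : Type := seq (seq nat * nat).
Definition columns (x : wsum) : word_sum := [seq (t.1, col t.2) | t <- x].

(* [insubd] goes through an opaque reflection lemma and does not compute. *)
Definition colval (n : nat) : nat :=
  if (n == 1%N) || (0 < n)%N && ~~ odd n then n else 1%N.
Lemma val_col n : val (col n) = colval n.
Proof. exact: val_insubd. Qed.

Definition D0_d1 (x : wsum) : D0_list :=
  D0_sum x (fun t => D0_mul (D0_word t.1) (D0_Sq (colval t.2))).

Lemma d1D_liftF x : d1D (liftF (columns x)) = evD (D0_d1 x).
Proof.
have fD (c : column) : {morph mulD^~ (Sqt (val c)) : a b / a + b} by exact: mulD_additive.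
rewrite evD_sum -[LHS]/(lin_ext (fun c a => mulD a (Sqt (val c))) _) /liftF.
rewrite (morphD_sum (lin_extD fD)) big_map; apply: eq_bigr => t _ /=.
by rewrite (lin_extU fD) val_col evD_mul evD_word evD_Sq.
Qed.

(* The factor 3 is -1 modulo 4. *)
Definition D0_eq (x y : D0_list) : bool :=
  is_zero 4 (x.1 ++ [seq (3 * t.1, t.2)%N | t <- y.1]) && is_zeroK (x.2 ++ y.2).

(** In characteristic 2 an equality amounts to the vanishing of a sum, that is, of a concatenation
    of lists. *)
Lemma F2_addKK (K : choiceType) (x y : {malg A[K]}) : x + y = 0 -> x = y.
Proof.
have yy : y + y = 0.
  apply/malgP => k; apply/malgP => r; rewrite mcoeffD mcoeff0 -mulr2n mcoeffMn mcoeff0.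
  by rewrite -mulr_natr pchar_F2 mulr0.
by move=> xy; apply: (addIr y); rewrite xy yy.
Qed.

Lemma evD_eq x y : D0_eq x y -> evD x = evD y.
Proof.
case/andP => /(ev_is_zero pchar_Z4) z1 /(evK_is_zero ykey) z2.
rewrite /evD; congr (_, _); last by apply: F2_addKK; rewrite -evK_cat.
(* After adding 3 y to both sides the left one vanishes by hypothesis and the right one is 4 y =
   0. *)
apply: (addIr (ev 'Z_4 [seq (3 * t.1, t.2)%N | t <- y.1])).
rewrite -ev_cat z1 /ev big_map -big_split /= big1 // => t _.
by rewrite -monalgUD -natrD -mulSn natrM pchar_Z4 mul0r monalgU0.
Qed.

Lemma mu0D : {morph mu0 : a b / a + b}.
Proof. by move=> a b; congr (_, _, _); rewrite addr0. Qed.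

Lemma inAD : {morph inA : a b / a + b}.
Proof. by move=> a b; congr (_, _, _); rewrite addr0. Qed.

Lemma UeltD p : {morph Uelt p : a b / a + b}.
Proof. by move=> a b; rewrite /Uelt monalgUD; congr (_, _, _); rewrite addr0. Qed.

Lemma morphD_add (V W : zmodType) (f g : V -> W) :
  {morph f : x y / x + y} -> {morph g : x y / x + y} ->
  {morph (fun x => f x + g x) : x y / x + y}.
Proof. by move=> fD gD x y; rewrite fD gD addrACA. Qed.

Lemma morphD_mulAr (W : zmodType) (f : A -> W) (a : A) :
  {morph f : x y / x + y} -> {morph (fun b => f (mulA a b)) : x y / x + y}.
Proof. by move=> fD x y; rewrite mulADr fD. Qed.

Lemma UtermD k l : {morph Uterm k l : a b / a + b}.
Proof.
move=> a b; rewrite /Uterm; case: (k == l).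
  exact: (morphD_add (f := fun x => mu0 (mulA (SqR (xi k.+1 1)) x))
    (g := fun x => inA (mulA (SqR (xi k 2)) x))
    (morphD_mulAr _ mu0D) (morphD_mulAr _ inAD)).
case: (k < l)%N; first exact: UeltD.
exact: (morphD_add (g := fun x => inA (mulA (SqR (exp_add (xi k 1) (xi l 1))) x))
  (@UeltD _) (morphD_mulAr _ inAD)).
Qed.

(** The empty exponent sequence leaves only i = j = 0, and the indices of a [ypair] are already in
    order, so no correction term of [Uterm] appears. This removes empty words from [adem_tracks]. *)
Lemma left_expand_one y : left_expand Uterm oneA y = (0, 0, y).
Proof.
have UD1 : {morph (fun y : {malg A[ypair]} => (0, 0, y) : D1) : a b / a + b}.
  by move=> a b; congr (_, _, _); rewrite addr0.
rewrite [in RHS](monalgE y) (morphD_sum UD1) {1}(monalgE y).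
rewrite (morphD_sum (left_expandDr UtermD _)); apply: eq_bigr => p _.
rewrite (left_expandUU UtermD) /expand_basis /= !big_ord1 !addn0.
have -> : cap (exp_add (xi 0 (2 ^ (val p).1)) (xi 0 (2 ^ (val p).2)))
              << 1 *g mexp [::] >> = oneA.
  by rewrite capE (lin_extU (@cap_basisD _)).
rewrite mulA1l /Uterm.
have lt := valP p; rewrite /= in lt; rewrite ltn_eqF // lt.
congr (_, _, << _ *g _ >>); apply: val_inj; rewrite val_insubd /=.
by rewrite (minn_idPl (ltnW lt)) (maxn_idPr (ltnW lt)) lt; case: (val p).
Qed.

Lemma lactD1_one x : lactD1 oneA x = x.
Proof.
have k0 : kappa oneA = 0 by rewrite /kappa capE (lin_extU (@cap_basisD _)).
rewrite /lactD1 k0 mul0A !mulA1l left_expand_one.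
by case: x => [[a b] y]; congr (_, _, _); rewrite /= ?addr0 ?add0r.
Qed.

Lemma ractD1_one x : ractD1 x oneA = x.
Proof.
case: x => [[a b] y]; rewrite /ractD1 !mulA1r /=; congr (_, _, _).
by rewrite [RHS]monalgE; apply: eq_bigr => p _; rewrite mulA1r.
Qed.

Lemma boundary_add h k x y :
  boundary h = evD x -> boundary k = evD y -> boundary (h + k) = evD (D0_add x y).
Proof.
rewrite evD_add => <- <-; rewrite /boundary twiceD -addrACA; congr (_ + _).
by congr (_, _); rewrite addr0.
Qed.

Lemma boundary_mu0 w : boundary (mu0 (wordA w)) = evD (D0_twice (word_list w)).
Proof. by rewrite evD_twice evA_word /boundary /= addr0. Qed.

Lemma is_track_eval h x y :
  boundary h = evD y -> D0_eq y (D0_d1 x) -> is_track h (columns x).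
Proof. by rewrite /is_track d1D_liftF => -> /evD_eq ->. Qed.

Section Tracks.
Variables (u : nat -> nat -> D1) (hu : adem_tracks u).

(** The last factor is the lift of the empty word [beta] in [adem_tracks]; it is evaluated as it
    stands. *)
Definition D0_adem_act (w : seq nat) (a b : nat) : D0_list :=
  D0_mul (D0_mul (D0_word w) (D0_adem a b)) D0_one.

Lemma boundary_act w a b : (0 < a)%N -> (a < 2 * b)%N ->
  boundary (lactD1 (wordA w) (u a b)) = evD (D0_adem_act w a b).
Proof.
move=> a0 ab; have := hu a0 ab w [::]; rewrite ractD1_one => ->.
by rewrite !evD_mul evD_word evD_adem evD_one.
Qed.

Lemma boundary_u a b : (0 < a)%N -> (a < 2 * b)%N ->
  boundary (u a b) = evD (D0_adem_act [::] a b).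
Proof. by move=> a0 ab; rewrite -(boundary_act [::]) // lactD1_one. Qed.

Lemma Sq_word n : Sq n = wordA [:: n].
Proof. by rewrite /= mulA1r. Qed.

(** The relations used for [z5] produce Sq^2 Sq^3 and Sq^5 twice each, and [4,4] and [2,6] both
    contain Sq^7 Sq^1. Each [mu0] term contributes another 2, which completes these duplicates to
    multiples of 4. *)
Lemma tracks :
  [/\ is_track (u 1 1)%N q2,
      is_track (u 2 2)%N z4,
      is_track (lactD1 (Sq 2) (u 1 2)%N + u 2%N 3%N + u 1%N 4%N
                + mu0 (wordA [:: 2; 3]%N) + mu0 (wordA [:: 5]%N)) z5,
      is_track (u 2 4)%N rt6
    & is_track (u 4%N 4%N + u 2%N 6%N + mu0 (wordA [:: 7; 1]%N)) z8].
Proof.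
split.
(* The witness repeats the syzygy with numbered columns; [columns] turns it back into [q2] by
   conversion. *)
- apply: (@is_track_eval _ [:: ([:: 1], 1)]%N); first exact: boundary_u.
  by vm_compute.
- apply: (@is_track_eval _ [:: ([:: 2], 2); ([:: 3], 1)]%N); first exact: boundary_u.
  by vm_compute.
(* [Sq 2] has to appear as the word [alpha] of [adem_tracks]. *)
- rewrite Sq_word.
  apply: (@is_track_eval _ [:: ([:: 2; 1], 2); ([:: 1], 4); ([:: 4], 1)]%N).
    apply: boundary_add (boundary_mu0 [:: 5]%N).
    apply: boundary_add (boundary_mu0 [:: 2; 3]%N).
    apply: boundary_add (boundary_u _ _) => //.
    exact: boundary_add (boundary_act _ _ _) (boundary_u _ _).
  by vm_compute.
- apply: (@is_track_eval _ [:: ([::], 6); ([:: 2], 4); ([:: 5], 1)]%N).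
    exact: boundary_u.
  by vm_compute.
- apply: (@is_track_eval _ [:: ([:: 6], 2); ([:: 4], 4); ([:: 2], 6)]%N).
    apply: boundary_add (boundary_mu0 [:: 7; 1]%N).
    exact: boundary_add (boundary_u _ _) (boundary_u _ _).
  by vm_compute.
Qed.

End Tracks.

(** * The Milnor product is graded *)

Lemma sumn_mkseq f n : sumn (mkseq f n) = (\sum_(i < n) f i)%N.
Proof. by rewrite sumnE big_map -[n in iota _ n]subn0 -/(index_iota 0 n) big_mkord. Qed.

Lemma exp_degE r n : (size r <= n)%N ->
  exp_deg r = (\sum_(i < n) nth 0 r i * (2 ^ i.+1 - 1))%N.
Proof.
move=> le_rn; rewrite /exp_deg sumn_mkseq.
rewrite (big_ord_widen n (fun i => nth 0 r i * (2 ^ i.+1 - 1))%N le_rn) big_mkcond.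
by apply: eq_bigr => i _; case: ltnP => // ge; rewrite nth_default.
Qed.

Lemma exp_deg_trim r : exp_deg (trim r) = exp_deg r.
Proof.
rewrite (exp_degE (leq_maxl (size (trim r)) (size r))).
rewrite (exp_degE (leq_maxr (size (trim r)) (size r))).
by apply: eq_bigr => i _; rewrite nth_trim.
Qed.

(** Since [F] vanishes outside the rectangle, both sides can be extended to a common range;
    exchanging the sums and substituting k = i + j identifies them. *)
Lemma sum_antidiagonals (F : nat -> nat -> nat) m n :
  (forall i j, (m < i)%N || (n < j)%N -> F i j = 0%N) ->
  (\sum_(k < (m + n).+1) \sum_(i < k.+1) F i (k - i)
   = \sum_(i < m.+1) \sum_(j < n.+1) F i j)%N.
Proof.
move=> F0; have le_m : (m.+1 <= (m + n).+1)%N by rewrite ltnS leq_addr.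
rewrite (big_ord_widen _ (fun i => \sum_(j < n.+1) F i j)%N le_m) [RHS]big_mkcond /=.
transitivity (\sum_(k < (m + n).+1) \sum_(i < (m + n).+1 | (i <= k)%N) F i (k - i))%N.
  apply: eq_bigr => k _.
  by rewrite (big_ord_widen _ (fun i => F i (k - i))%N (ltn_ord k)).
rewrite (exchange_big_dep xpredT) //=; apply: eq_bigr => i _.
case: ltnP => [le_im|lt_mi]; last by rewrite big1 // => k _; rewrite F0 ?lt_mi.
have le_n : (n.+1 <= (m + n).+1 - i)%N by lia.
transitivity (\sum_(j < (m + n).+1 - i) F i j)%N.
  rewrite -(big_mkord xpredT (F i)) -(big_mkord (leq i) (fun k => F i (k - i))%N).
  move: (nat_of_ord i) (ltn_ord i) => a lt_a.
  (* The indices k below a fail the condition a <= k; the remaining range is shifted down by a. *)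
  rewrite (big_cat_nat (n := a)) //=; last by lia.
  rewrite big1_seq ?add0n => [|k]; last by rewrite mem_index_iota; lia.
  have := big_addn 0 (m + n).+1 a (leq a) (fun k => F a (k - a))%N; rewrite add0n => ->.
  rewrite big_mkcond; apply: eq_bigr => k _.
  by rewrite leq_addl addnK.
rewrite (big_ord_widen _ (F i) le_n) [RHS]big_mkcond; apply: eq_bigr => j _.
by case: ltnP => // lt_nj; rewrite F0 // lt_nj orbT.
Qed.

Lemma matrices_below_size m s X : X \in matrices_below m s ->
  size X = m /\ all (fun x => size x == size s) X.
Proof.
elim: m X => [|m IH] X /=; first by rewrite inE => /eqP ->.
case/allpairsP => -[x Y] /= [xs /IH[<- aY] ->] /=; split=> //; rewrite aY andbT.
elim: s {aY Y IH X} x xs => [|c s IH] x; first by rewrite inE => /eqP ->.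
by case/allpairsP => -[y z] /= [_ /IH/eqP <- ->].
Qed.

(** The degree of the product exponent is the sum of e_ij (2^(i+j) - 1) over the Milnor matrix.
    Splitting each weight distributes it between the weighted row sums giving [r] and the column
    sums giving [s]. *)
Lemma exp_deg_mul r s X : X \in milnor_interiors r s ->
  exp_deg (milnor_exponent r s X) = (exp_deg r + exp_deg s)%N.
Proof.
rewrite mem_filter => /andP[/andP[/allP rowX /allP colX] /matrices_below_size[sX aX]].
set m := size r; set n := size s; set e := milnor_entry r s X.
have x0 i j : (m <= i)%N || (n <= j)%N -> interior X i j = 0%N.
  rewrite /interior; case/orP => le.
    by rewrite (nth_default _ (s := X)) ?sX ?nth_nil.
  case: (ltnP i (size X)) => li; last by rewrite (nth_default _ (s := X)) ?nth_nil.
  by rewrite nth_default // (eqP (allP aX _ (mem_nth _ li))).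
have e0 i j : (m < i)%N || (n < j)%N -> e i j = 0%N.
  case: i j => [|i] [|j]; rewrite /e //= ?ltnS ?orbF => h; last exact: x0.
    by rewrite nth_default.
  by rewrite nth_default.
(* The filter in [milnor_interiors] ensures that the subtraction in [milnor_entry] is not
   truncated. *)
have row i : (i < m)%N ->
    (nth 0 r i = e i.+1 0 + \sum_(j < n) 2 ^ j.+1 * interior X i j)%N.
  move=> lt; have := rowX i; rewrite mem_iota => /(_ lt).
  by rewrite /e /= /row_weight sumn_mkseq => le; rewrite subnK.
have column j : (j < n)%N -> (nth 0 s j = e 0 j.+1 + \sum_(i < m) interior X i j)%N.
  move=> lt; have := colX j; rewrite mem_iota => /(_ lt).
  by rewrite /e /= /col_weight sumn_mkseq => le; rewrite subnK.
(* Recorded here because the body of [e] is cleared below. *)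
have inner i j : e i.+1 j.+1 = interior X i j by [].
rewrite (exp_degE (n := m + n)) ?size_mkseq //.
(* Position k of the exponent is the antidiagonal i + j = k + 1. The antidiagonal 0 is added for
   free, with weight 2^0 - 1 = 0. *)
transitivity (\sum_(k < (m + n).+1) \sum_(i < k.+1)
                e i (k - i) * (2 ^ (i + (k - i)) - 1))%N.
  rewrite [RHS]big_ord_recl big_ord1 muln0 add0n; apply: eq_bigr => k _.
  rewrite nth_mkseq // sumn_mkseq big_distrl; apply: eq_bigr => i _ /=.
  by rewrite subnKC // -ltnS.
clearbody e.
rewrite (sum_antidiagonals (F := fun i j => e i j * (2 ^ (i + j) - 1))%N);
  last by move=> i j h; rewrite e0.
rewrite (exp_degE (leqnn m)) (exp_degE (leqnn n)) big_ord_recl big_ord_recl muln0 add0n.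
(* 2^(i+j+2) - 1 = 2^(j+1) (2^(i+1) - 1) + (2^(j+1) - 1): the two summands are the
   contributions of the entry (i+1, j+1) to the degrees of r and of s. *)
have -> : (\sum_(j < n) nth 0 s j * (2 ^ j.+1 - 1)
  = \sum_(j < n) e 0 j.+1 * (2 ^ j.+1 - 1)
    + \sum_(i < m) \sum_(j < n) interior X i j * (2 ^ j.+1 - 1))%N.
  rewrite exchange_big -big_split; apply: eq_bigr => j _ /=.
  by rewrite (column _ (ltn_ord j)) mulnDl big_distrl.
rewrite addnC [RHS]addnCA [RHS]addnC; congr addn.
rewrite -big_split; apply: eq_bigr => i _ /=.
rewrite (row _ (ltn_ord i)) big_ord_recl addn0 mulnDl -addnA; congr addn.
rewrite big_distrl -big_split; apply: eq_bigr => j _ /=.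
rewrite /bump /= !add1n addSn addnS -addSn -addnS expnD.
have := expn_gt0 2 i.+1; have := expn_gt0 2 j.+1; rewrite /= inner.
(* Both powers are positive; written as successors, they make the subtractions of 1 exact. *)
case: (2 ^ i.+1)%N (2 ^ j.+1)%N => [|a] [|b] // _ _; rewrite mulSn addSn !subn1 /=; nia.
Qed.

(** * Bases in low degrees *)

Lemma homogA_coef n a r : homogA n a -> a@_r != 0 -> exp_deg (val r) = n.
Proof. by move=> ha; rewrite mcoeff_neq0 => /ha. Qed.

Lemma homogA_sum (I : eqType) n (s : seq I) (F : I -> A) :
  (forall i, i \in s -> homogA n (F i)) -> homogA n (\sum_(i <- s) F i).
Proof.
move=> hF; rewrite big_seq; apply: big_ind => //.
  by move=> r; rewrite msupp0.
move=> a b ha hb r rab; have := fsubsetP (msuppD_le a b) r rab.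
by rewrite in_fsetU => /orP[/ha|/hb].
Qed.

Lemma homogAU n c r : exp_deg (val r) = n -> homogA n << c *g r >>.
Proof. by move=> hr s /(fsubsetP msuppU_le); rewrite in_fset1 => /eqP ->. Qed.

Lemma homogA_mul p q a b : homogA p a -> homogA q b -> homogA (p + q) (mulA a b).
Proof.
move=> ha hb; apply: homogA_sum => r /ha <-; apply: homogA_sum => s /hb <-.
apply: homogA_sum => X /exp_deg_mul eX; apply: homogAU.
by rewrite /= exp_deg_trim.
Qed.

Lemma malg_enum (K : choiceType) (G : zmodType) (x : {malg G[K]}) (s : seq K) :
  uniq s -> (forall k, x@_k != 0 -> k \in s) -> x = \sum_(k <- s) << x@_k *g k >>.
Proof.
move=> us xs; apply/malgP => k; rewrite (morphD_sum (mcoeffD k)).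
have [ks|ks] := boolP (k \in s).
  rewrite (bigD1_seq k) //= mcoeffUU big1 ?addr0 // => j /negPf jk.
  by rewrite mcoeffU jk.
rewrite big1_seq => [|j /= js]; last by rewrite mcoeffU; case: eqP js ks => // -> ->.
by apply/eqP/negPn; apply: contra ks; apply: xs.
Qed.

(** The ranges suffice for degrees up to 8: xi_1, xi_2, xi_3 have degrees 1, 3, 7, so their
    exponents are at most 8, 2, 1, while xi_4 already has degree 15. *)
Definition exps (p : nat) : seq (seq nat) :=
  [seq r <- [seq trim (rcons q c) | q <- [seq [:: a; b] | a <- iota 0 9, b <- iota 0 3],
                                    c <- iota 0 2] | exp_deg r == p].

(** The last entry is nonzero and alone contributes at least this much. *)
Lemma exp_deg_size r : last 1%N r != 0%N -> (2 ^ size r - 1 <= exp_deg r)%N.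
Proof.
case: r => // a r l0; rewrite (exp_degE (leqnn _)) big_ord_recr /=.
apply: leq_trans (leq_addl _ _).
by rewrite (nth_last 0%N (a :: r)) leq_pmull // lt0n.
Qed.

Lemma mem_exps (r : milnor_exp) p :
  (p <= 8)%N -> exp_deg (val r) = p -> r \in [seq mexp s | s <- exps p].
Proof.
move=> p8 rp; have r_last := valP r; have := exp_deg_size r_last; rewrite rp => sz.
have sz3 : (size (val r) <= 3)%N.
  by rewrite leqNgt; apply/negP => /(leq_pexp2l (isT : 0 < 2)%N); lia.
set a := nth 0%N (val r) 0; set b := nth 0%N (val r) 1; set c := nth 0%N (val r) 2.
have er : val r = trim [:: a; b; c].
  rewrite -[LHS](trim_id r_last); apply: trim_eq => -[|[|[|i]]] //.
  by rewrite (nth_default 0%N (leq_trans sz3 (isT : 3 <= i.+3)%N)) /= nth_nil.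
have deg : (a * 1 + (b * 3 + (c * 7 + 0)))%N = p by rewrite -rp er exp_deg_trim.
apply/mapP; exists (val r); last by rewrite mexp_val.
rewrite mem_filter rp eqxx er andTb; apply/allpairsP; exists ([:: a; b], c).
split=> //; last by rewrite mem_iota /=; lia.
by apply/allpairsP; exists (a, b); rewrite !mem_iota; split=> //=; lia.
Qed.

Lemma exps_uniq p : (p <= 8)%N -> uniq [seq mexp s | s <- exps p].
Proof.
move=> p8; apply: (map_uniq (f := val)); rewrite -map_comp.
have : all (fun p => uniq [seq trim s | s <- exps p]) (iota 0 9) by vm_compute.
by move/allP; apply; rewrite mem_iota.
Qed.

Lemma F2_nonzero (c : 'F_2) : c != 0 -> c = 1.
Proof. by case: c => [[|[|c]] hc] // _; apply/val_inj. Qed.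

Lemma evA_if (a : A) r :
  << a@_(mexp r) *g mexp r >> = if a@_(mexp r) != 0 then evA [:: (1%N, r)] else 0.
Proof.
by case: eqP => [->|/eqP/F2_nonzero ->] /=; rewrite ?monalgU0 // /evA ev1.
Qed.

Lemma homogA_enum p a : (p <= 8)%N -> homogA p a ->
  a = \sum_(r <- exps p) (if a@_(mexp r) != 0 then evA [:: (1%N, r)] else 0).
Proof.
move=> p8 ha; rewrite {1}(malg_enum (x := a) (exps_uniq p8)) => [|r /(homogA_coef ha)].
  by rewrite big_map; apply: eq_bigr => r _; rewrite evA_if.
exact: mem_exps.
Qed.

Definition evF : seq (nat * term) -> F := evK col.

Definition cols (n : nat) : seq nat := [seq c <- [:: 1; 2; 4; 6; 8]%N | (c <= n)%N].

Definition basisF (n : nat) : seq (nat * term) :=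
  [seq (c, (1%N, r)) | c <- cols n, r <- exps (n - c)].

Lemma homogF_col n x c : homogF n x -> homogA (n - val c) (x@_c).
Proof.
move=> hx r rx; have cx : c \in msupp x.
  by rewrite -mcoeff_neq0; apply: contraTneq rx => ->; rewrite msupp0.
by rewrite -(hx c r cx rx) addnK.
Qed.

Lemma homogF_le n x c : homogF n x -> x@_c != 0 -> (val c <= n)%N.
Proof.
move=> hx xc; have [r rx] : exists r, r \in msupp (x@_c).
  apply/fset0Pn; apply: contra_neq xc => e.
  by rewrite [LHS](@monalgE milnor_exp 'F_2) e big_seq_fset0.
by rewrite -(hx c r _ rx) ?leq_addl // -mcoeff_neq0.
Qed.

Lemma mem_cols n (c : column) : (n <= 8)%N -> (val c <= n)%N ->
  c \in [seq col c | c <- cols n].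
Proof.
move=> n8 cn; apply/mapP; exists (val c); last by rewrite /col valKd.
rewrite mem_filter cn /=; case: c cn => c /= hc cn; rewrite !inE.
by have := leq_trans cn n8; case: c hc {cn} => [|[|[|[|[|[|[|[|[|c]]]]]]]]].
Qed.

Lemma cols_uniq n : uniq [seq col c | c <- cols n].
Proof.
apply: (map_uniq (f := val)); rewrite -map_comp.
suff -> : [seq (val \o col) c | c <- cols n] = cols n by rewrite filter_uniq.
rewrite -[RHS]map_id; apply/eq_in_map => c /=.
rewrite mem_filter val_col !inE => /andP[_].
by case/or4P => [/eqP->|/eqP->|/eqP->|/orP[]/eqP->].
Qed.

(** Over F_2 an element is the sum of the monomials in its support, so homogeneous elements
    correspond to sublists of a finite basis. *)
Lemma homogF_enum n x : (n <= 8)%N -> homogF n x ->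
  x = evF [seq t <- basisF n | x@_(col t.1)@_(mexp t.2.2) != 0].
Proof.
move=> n8 hx; rewrite {1}(malg_enum (x := x) (cols_uniq n)) => [|c xc]; last first.
  exact: mem_cols (homogF_le hx xc).
rewrite /evF /evK [RHS]big_filter [RHS]big_mkcond [RHS]big_allpairs_dep big_map /=.
rewrite big_seq [RHS]big_seq.
apply: eq_bigr => c; rewrite mem_filter => /andP[cn c8].
have hc := homogF_col (c := col c) hx.
have -> : (n - c)%N = (n - val (col c))%N.
  rewrite val_col; move: c8; rewrite !inE.
  by case/or4P => [/eqP->|/eqP->|/eqP->|/orP[]/eqP->].
rewrite {1}(homogA_enum (leq_trans (leq_subr _ _) n8) hc).
rewrite (morphD_sum (@monalgUD _ _ _)); apply: eq_bigr => r _.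
by case: ifP => // _; rewrite monalgU0.
Qed.

(** * Syzygies of degree at most 8 *)

(** Converse of [ev_is_zero] for q = 2; it guarantees that filtering by the test loses no syzygy. *)
Lemma evA_eq0 x : evA x = 0 -> is_zero 2 x.
Proof.
move=> x0; apply/allP => t _; have := coef_ev 'F_2 x t.2.
rewrite [ev _ x]x0 mcoeff0 => /esym.
by move/(congr1 (@nat_of_ord _)); rewrite val_Fp_nat // => /eqP.
Qed.

Fixpoint sublists (T : Type) (s : seq T) : seq (seq T) :=
  if s is x :: s' then map (cons x) (sublists s') ++ sublists s' else [:: [::]].

Lemma filter_sublists (T : eqType) (P : pred T) s : [seq x <- s | P x] \in sublists s.
Proof.
elim: s => //= x s IH; rewrite mem_cat; case: (P x); last by rewrite IH orbT.
by rewrite map_f.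
Qed.

Lemma mem_sublists (T : eqType) (s t : seq T) : t \in sublists s -> {subset t <= s}.
Proof.
elim: s t => [|x s IH] t /=; first by rewrite inE => /eqP ->.
rewrite mem_cat => /orP[/mapP[t' /IH ts' ->]|/IH ts] y.
  by rewrite !inE => /predU1P[->|/ts' ->]; rewrite ?eqxx ?orbT.
by rewrite inE => /ts ->; rewrite orbT.
Qed.

Lemma evF_cat x y : evF (x ++ y) = evF x + evF y. Proof. exact: evK_cat. Qed.

Lemma evF_flatten s : evF (flatten s) = \sum_(x <- s) evF x.
Proof.
elim: s => [|x s IH] /=; first by rewrite big_nil /evF /evK big_nil.
by rewrite evF_cat IH big_cons.
Qed.

Definition d1_list (x : seq (nat * term)) : seq term :=
  [seq t' | t <- x, t' <- mul_list 2 [:: t.2] [:: (1, [:: colval t.1])]%N].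

Lemma d1A_evF x : d1A (evF x) = evA (d1_list x).
Proof.
have fD (c : column) : {morph mulA^~ (Sq (val c)) : a b / a + b} by exact: mulADl.
rewrite -[LHS]/(lin_ext (fun c a => mulA a (Sq (val c))) _) /evF /evK.
rewrite (morphD_sum (lin_extD fD)) [RHS]ev_allpairs; apply: eq_bigr => t _.
rewrite (lin_extU fD) map_id [RHS]evA_mul val_col; congr mulA.
by rewrite /evA ev1.
Qed.

Definition act_list (r : seq nat) (x : seq (nat * term)) : seq (nat * term) :=
  [seq (t.1, s) | t <- x, s <- mul_list 2 [:: (1%N, r)] [:: t.2]].

Lemma actF_evF r x : actF (SqR r) (evF x) = evF (act_list r x).
Proof.
have fD (c : column) :
    {morph (fun a : A => << mulA (SqR r) a *g c >> : F) : a b / a + b}.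
  by move=> a b; rewrite mulADr monalgUD.
rewrite [RHS]evK_allpairs -[LHS]/(lin_ext (fun c a => << mulA (SqR r) a *g c >>) _).
rewrite /evF /evK (morphD_sum (lin_extD fD)); apply: eq_bigr => t _.
rewrite (lin_extU fD) evA_mul; congr << mulA _ _ *g _ >>.
by rewrite /evA ev1.
Qed.

(** Two numbers have the same [colval] exactly when they name the same column under [col]. *)
Definition component (c : nat) (x : seq (nat * term)) : seq term :=
  [seq t.2 | t <- x & colval t.1 == colval c].

Lemma coef_evF c x : (evF x)@_(col c) = evA (component c x).
Proof.
rewrite /evF /evK (morphD_sum (mcoeffD _)) /component [RHS]evAE big_map big_filter.
rewrite [RHS]big_mkcond; apply: eq_bigr => t _.
by rewrite mcoeffU -val_eqE /= !val_col; case: eqP.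
Qed.

Lemma coef_map (K : choiceType) (G H : zmodType) (f : G -> H) (x : {malg G[K]}) c :
  f 0 = 0 -> (\sum_(k <- msupp x) << f x@_k *g k >>)@_c = f x@_c.
Proof.
move=> f0; rewrite (morphD_sum (mcoeffD c)).
have [xc|xc] := boolP (c \in msupp x); last first.
  rewrite (mcoeff_outdom xc) f0 big1_seq // => d /= xd.
  by rewrite mcoeffU; case: eqP xd xc => // -> ->.
rewrite (bigD1_seq c) ?fset_uniq //= mcoeffUU big1 ?addr0 // => d /negPf dc.
by rewrite mcoeffU dc.
Qed.

Lemma coef_actF a x c : (actF a x)@_c = mulA a (x@_c).
Proof. exact: (coef_map x c (mulA0 a)). Qed.

Lemma homogFD n x y : homogF n x -> homogF n y -> homogF n (x + y).
Proof.
move=> hx hy c r _; rewrite -mcoeff_neq0 !mcoeffD => nz.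
have [x0|xr] := eqVneq (x@_c@_r) 0.
  have yr : y@_c@_r != 0 by move: nz; rewrite x0 add0r.
  apply: hy; last by rewrite -mcoeff_neq0.
  by rewrite -mcoeff_neq0; apply: contra_neq yr => ->; rewrite mcoeff0.
apply: hx; last by rewrite -mcoeff_neq0.
by rewrite -mcoeff_neq0; apply: contra_neq xr => ->; rewrite mcoeff0.
Qed.

Lemma homogF_evF n x :
  all (fun t => exp_deg t.2.2 + colval t.1 == n)%N x -> homogF n (evF x).
Proof.
elim: x => [_|t x IH] /=; first by move=> c r; rewrite /evF /evK big_nil msupp0.
case/andP => /eqP ht /IH hx; rewrite -cat1s evF_cat; apply: homogFD => //.
rewrite /evF /evK big_seq1 => c r /(fsubsetP msuppU_le); rewrite in_fset1 => /eqP ->.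
rewrite mcoeffUU /evA ev1 => /(fsubsetP msuppU_le); rewrite in_fset1 => /eqP ->.
by rewrite /= exp_deg_trim val_col.
Qed.

Definition eval_list (x : wsum) : seq (nat * term) :=
  [seq (t.2, s) | t <- x, s <- word_list t.1].

Lemma evalF_columns x : evalF (columns x) = evF (eval_list x).
Proof.
rewrite [RHS]evK_allpairs /evalF big_map; apply: eq_bigr => t _ /=.
by rewrite evA_word.
Qed.

Definition degrees : seq nat := [:: 2; 4; 5; 6; 8]%N.

Definition rep (n : nat) : wsum :=
  match n with
  | 2 => [:: ([:: 1], 1)]
  | 4 => [:: ([:: 2], 2); ([:: 3], 1)]
  | 5 => [:: ([:: 2; 1], 2); ([:: 1], 4); ([:: 4], 1)]
  | 6 => [:: ([::], 6); ([:: 2], 4); ([:: 5], 1)]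
  | 8 => [:: ([:: 6], 2); ([:: 4], 4); ([:: 2], 6)]
  | _ => [::]
  end%N.

Lemma representativesE : representatives = [seq (n, columns (rep n)) | n <- degrees].
Proof. by []. Qed.

Definition rep_list (n : nat) : seq (nat * term) := eval_list (rep n).

Lemma syzygy_rep n : n \in degrees -> syzygy n (evF (rep_list n)).
Proof.
move=> nd; have : all (fun n =>
    all (fun t => exp_deg t.2.2 + colval t.1 == n)%N (rep_list n)
    && is_zero 2 (d1_list (rep_list n))) degrees by vm_compute.
move/allP/(_ n nd)/andP => [hn zn]; split; first exact: homogF_evF.
by rewrite d1A_evF; apply: (ev_is_zero pchar_F2).
Qed.

(** Exhaustive search is feasible: the largest basis, in degree 8, has 11 monomials, hence 2048
    sublists. *)
Definition syzygies (n : nat) : seq (seq (nat * term)) :=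
  [seq x <- sublists (basisF n) | is_zero 2 (d1_list x)].

Lemma syzygy_enum n x : (n <= 8)%N -> syzygy n x ->
  exists2 y, y \in syzygies n & x = evF y.
Proof.
move=> n8 [hx x0]; move: (homogF_enum n8 hx); set y := filter _ _ => xy.
exists y => //; rewrite mem_filter filter_sublists andbT; apply: evA_eq0.
by rewrite -d1A_evF -xy.
Qed.

(* (r, k) stands for Sq(r) times the representative of degree k; those listed form
   a basis of the decomposable syzygies of degree n. *)
Definition multiples (n : nat) : seq (seq nat * nat) :=
  match n with
  | 4 => [:: ([:: 2], 2)]
  | 5 => [:: ([:: 0; 1], 2); ([:: 1], 4)]
  | 6 => [:: ([:: 4], 2); ([:: 2], 4)]
  | 7 => [:: ([:: 2; 1], 2); ([:: 0; 1], 4); ([:: 2], 5); ([:: 1], 6)]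
  | 8 => [:: ([:: 0; 2], 2); ([:: 6], 2); ([:: 1; 1], 4); ([:: 4], 4);
             ([:: 0; 1], 5); ([:: 2], 6)]
  | _ => [::]
  end%N.

Definition multiple_list (p : seq nat * nat) : seq (nat * term) :=
  act_list p.1 (rep_list p.2).

Lemma decomposable_multiple n p :
  (n <= 8)%N -> p \in multiples n -> decomposable n (evF (multiple_list p)).
Proof.
move=> n8 pn; have : all (fun n => all (fun p =>
    [&& 0 < exp_deg p.1, p.2 < n & p.2 \in degrees]%N) (multiples n)) (iota 0 9).
  by vm_compute.
move/allP/(_ n); rewrite mem_iota => /(_ n8)/allP/(_ p pn)/and3P[p0 lt pd].
rewrite -actF_evF; apply: decomposableM p0 _ lt (syzygy_rep pd).
by apply: homogAU; rewrite /= exp_deg_trim.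
Qed.

Lemma decomposable_sum n s : (forall x, x \in s -> decomposable n (evF x)) ->
  decomposable n (evF (flatten s)).
Proof.
move=> hs; rewrite evF_flatten big_seq; apply: big_ind => //.
  exact: decomposable0.
exact: decomposableD.
Qed.

(** Sublists of the multiples run through all their F_2-combinations. Every syzygy is found to be
    such a combination, possibly plus one copy of the representative. *)
Lemma syzygies_span : all (fun n => all (fun x =>
    has (fun s => is_zeroK (x ++ flatten s)
                  || (n \in degrees) && is_zeroK (x ++ rep_list n ++ flatten s))
      (sublists (map multiple_list (multiples n)))) (syzygies n)) (iota 0 9).
Proof. by vm_compute. Qed.

Lemma syzygy_cases n x : (n <= 8)%N -> syzygy n x ->
  decomposable n x \/ n \in degrees /\ decomposable n (x - evF (rep_list n)).
Proof.
move=> n8 /(syzygy_enum n8)[y ys ->].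
have := allP syzygies_span n; rewrite mem_iota => /(_ n8)/allP/(_ y ys)/hasP[s sm].
have ds : decomposable n (evF (flatten s)).
  apply: decomposable_sum => z /(mem_sublists sm)/mapP[p pn ->].
  exact: decomposable_multiple.
case/orP => [/(evK_is_zero col)|/andP[nd /(evK_is_zero col)]].
  by rewrite -/(evF _) evF_cat => /F2_addKK ->; left.
rewrite -/(evF _) !evF_cat => /F2_addKK ->; right; split=> //.
by rewrite addrAC subrr add0r.
Qed.

(* A monomial (c, r), meaning Sq(r) e_c, that occurs in the representative of
   degree n but in no decomposable element. *)
Definition marker (n : nat) : nat * seq nat :=
  match n with
  | 4 => (2, [:: 2])
  | 5 => (4, [:: 1])
  | 6 => (6, [::])
  | 8 => (4, [:: 4])
  | _ => (1, [:: 1])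
  end%N.

(** The last test runs over all syzygies of lower degree, as [decomposable] does, and not only over
    the representatives. *)
Lemma marker_check : all (fun n =>
  [&& (exp_deg (marker n).2 + colval (marker n).1 == n)%N,
      odd (coef_list (component (marker n).1 (rep_list n)) (marker n).2)
    & all (fun m => all (fun x => all (fun r =>
        2 %| coef_list (mul_list 2 [:: (1, r)] (component (marker n).1 x)) (marker n).2)%N
        (exps (n - m))) (syzygies m)) (iota 0 n)]) degrees.
Proof. by vm_compute. Qed.

Lemma F2_even m : (2 %| m)%N -> m%:R = 0 :> 'F_2.
Proof. by case/dvdnP => k ->; rewrite natrM pchar_F2 mulr0. Qed.

(** The marker coefficient is additive, so one multiple [actF a z] is enough. [decomposable] does
    not impose p + m = n: the grading handles the other values of [p], and [marker_check] handles
    this one. *)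
Lemma decomposable_marker n x : n \in degrees -> decomposable n x ->
  x@_(col (marker n).1)@_(mexp (marker n).2) = 0.
Proof.
move=> nd; have n8 : (n <= 8)%N by move: n nd; apply/allP.
have /and3P[/eqP mk _ chk] := allP marker_check n nd.
elim=> [|x1 x2 _ h1 _ h2|p a m z p0 ha mn hz]; first by rewrite !mcoeff0.
  by rewrite !mcoeffD h1 h2 addr0.
rewrite coef_actF; apply/eqP/negPn/negP => nz.
have z0 : z@_(col (marker n).1) != 0.
  by apply: contra_neq nz => ->; rewrite mulA0 mcoeff0.
(* The column degree is at most m, so the subtraction in [homogF_col] is exact and the marker degree
   forces p + m = n. *)
have := homogF_le hz.1 z0; rewrite val_col => le_m.
have := homogA_coef (homogA_mul ha (homogF_col (c := col (marker n).1) hz.1)) nz.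
rewrite /= exp_deg_trim val_col => degp.
have ep : p = (n - m)%N by lia.
have [y ys ey] := syzygy_enum (leq_trans (ltnW mn) n8) hz.
case/negP: nz; have p8 : (p <= 8)%N by lia.
(* Expanding [a] on the Milnor basis reduces the claim to the products tested in [marker_check]. *)
rewrite (homogA_enum p8 ha) (morphD_sum (mulADl _)) (morphD_sum (mcoeffD _)).
rewrite big_seq big1 // => r rp; case: ifP => _; last by rewrite mul0A mcoeff0.
rewrite ey coef_evF -evA_mul [LHS]coef_ev; apply: F2_even.
move/allP: chk => /(_ m); rewrite mem_iota => /(_ mn)/allP/(_ y ys)/allP; apply.
by rewrite -ep.
Qed.

Lemma indecomposable_rep n : n \in degrees -> indecomposable_syzygy n (evF (rep_list n)).
Proof.
move=> nd; split; first exact: syzygy_rep.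
have /and3P[_ od _] := allP marker_check n nd.
move/(decomposable_marker nd); rewrite coef_evF.
rewrite [LHS]coef_ev => /(congr1 (@nat_of_ord _)).
by rewrite val_Fp_nat // modn2 od.
Qed.

(** * Even columns and the kernel of nu *)

Lemma even_part_evF x :
  even_part (evF x) = evF [seq t <- x | colval t.1 != 1%N].
Proof.
pose f (c : column) (a : A) : F := if c != col 1 then << a *g c >> else 0.
have fD c : {morph f c : a b / a + b}.
  by move=> a b; rewrite /f; case: ifP => _; rewrite ?monalgUD ?addr0.
rewrite /even_part big_mkcond -[LHS]/(lin_ext f _) /evF /evK.
rewrite (morphD_sum (lin_extD fD)) big_filter [RHS]big_mkcond; apply: eq_bigr => t _.
by rewrite (lin_extU fD) /f -val_eqE /= !val_col.
Qed.

Lemma nu_evF x : nu (evF x) = evA (d1_list [seq t <- x | colval t.1 != 1%N]).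
Proof.
pose f (c : column) (a : A) : A := if c != col 1 then mulA a (Sq (val c)) else 0.
have fD c : {morph f c : a b / a + b}.
  by move=> a b; rewrite /f; case: (c != col 1); [exact: mulADl | rewrite addr0].
rewrite /nu big_mkcond -[LHS]/(lin_ext f _) /evF /evK.
rewrite (morphD_sum (lin_extD fD)) [RHS]ev_allpairs big_filter [RHS]big_mkcond.
apply: eq_bigr => t _; rewrite (lin_extU fD) /f -val_eqE /= !val_col.
case: ifP => // _; rewrite map_id [RHS]evA_mul; congr mulA.
by rewrite /evA ev1.
Qed.

Lemma in_KF_evF x c : all (fun t => colval t.1 != 1%N) x ->
  is_zero 2 (d1_list x ++ mul_list 2 c [:: (1, [:: 1])]%N) -> in_KF (evF x).
Proof.
move=> xe /(ev_is_zero pchar_F2); rewrite -/(evA _) evA_cat => z; split.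
  rewrite /in_MF coef_evF /component (_ : [seq t <- x | _] = [::]) ?[LHS]big_nil //.
  rewrite -[RHS](filter_pred0 x); apply: eq_in_filter => t /(allP xe).
  by move/negPf.
exists (evA c); rewrite subr0 nu_evF (all_filterP xe).
have -> : Sq 1 = evA [:: (1, [:: 1])]%N by rewrite /evA ev1.
rewrite -evA_mul; apply/malgP => r.
have /malgP/(_ r) := z; rewrite mcoeffD mcoeff0.
(* Adding the coefficient of c Sq^1 to both sides cancels it on the left, since the characteristic
   is 2. *)
move/(congr1 (+%R^~ ((evA (mul_list 2 c [:: (1, [:: 1])]%N))@_r))).
by rewrite add0r -addrA -mulr2n -mulr_natr pchar_F2 mulr0 addr0.
Qed.

Lemma even_part_rep n w c :
  [seq t <- rep_list n | colval t.1 != 1%N] = eval_list w ->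
  is_zero 2 (d1_list (eval_list w) ++ mul_list 2 c [:: (1, [:: 1])]%N) ->
  even_part (evalF (columns (rep n))) = evalF (columns w) /\ in_KF (evalF (columns w)).
Proof.
move=> ew z; rewrite !evalF_columns even_part_evF ew; split=> //.
by apply: in_KF_evF z; rewrite -ew; apply: filter_all.
Qed.

Theorem lemma3p4 (u : nat -> nat -> D1) (hu : adem_tracks u) :
  [/\ (* the listed elements are indecomposable homogeneous syzygies ... *)
      forall t, t \in representatives -> indecomposable_syzygy t.1 (evalF t.2),
      (* ... and represent all the indecomposable ones of degree at most 8 *)
      forall (n : nat) (x : F), (n <= 8)%N -> indecomposable_syzygy n x ->
        exists2 t, t \in representatives &
          t.1 = n /\ decomposable n (x - evalF t.2),
      (* secondary tracks *)
      [/\ is_track (u 1 1)%N q2,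
          is_track (u 2 2)%N z4,
          is_track (lactD1 (Sq 2) (u 1 2)%N + u 2%N 3%N + u 1%N 4%N
                    + mu0 (wordA [:: 2; 3]%N) + mu0 (wordA [:: 5]%N)) z5,
          is_track (u 2 4)%N rt6
        & is_track (u 4%N 4%N + u 2%N 6%N + mu0 (wordA [:: 7; 1]%N)) z8]
    & (* even-column syzygies *)
      [/\ even_part (evalF z4) = evalF rho4 /\ in_KF (evalF rho4),
          even_part (evalF z5) = evalF rho5 /\ in_KF (evalF rho5),
          even_part (evalF rt6) = evalF r6 /\ in_KF (evalF r6)
        & even_part (evalF z8) = evalF rho8 /\ in_KF (evalF rho8)]].
Proof.
split.
- move=> t; rewrite representativesE => /mapP[n nd ->] /=.
  by rewrite evalF_columns; apply: indecomposable_rep.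
- move=> n x n8 [sx ix]; have [//|[nd dx]] := syzygy_cases n8 sx.
  exists (n, columns (rep n)); first by rewrite representativesE; apply: map_f.
  by rewrite evalF_columns.
- exact: tracks.
split.
(* The last argument is the coefficient of e_1 in the full syzygy: the vanishing of [d1A] says that
   [nu] equals this coefficient times Sq^1. It is Sq^3, Sq^4 and Sq^5 in the first three cases, and
   0 for [z8], which has no e_1 term. *)
- exact: (@even_part_rep 4 [:: ([:: 2], 2)]%N [:: (1, [:: 3])]%N).
- exact: (@even_part_rep 5 [:: ([:: 2; 1], 2); ([:: 1], 4)]%N [:: (1, [:: 4])]%N).
- exact: (@even_part_rep 6 [:: ([::], 6); ([:: 2], 4)]%N [:: (1, [:: 5])]%N).
- exact: (@even_part_rep 8 (rep 8) [::]).
Qed.
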